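(* Let $X=M+A$ be a càdlàg semi-martingale. Then the following are equivalent: (1) $X$ is of class $(\Sigma^{g})$; (2) there exist two predictable processes $C$ and $V$ (of finite variation) such that $A=C+V$ and, for all $t\ge 0$, $$\int_{0}^{t}1_{\{X_{s}\neq0\}}dC_{s}=\int_{0}^{t}1_{\{X_{s-}\neq0\}}dV_{s}=0.$$
   Context: Fix a filtered probability space $(\Omega,\mathcal{F},(\mathcal{F}_{t})_{t\geq0},\mathbf{P})$ satisfying the usual conditions. Writing a semi-martingale as $X=M+A$ means that $M$ is a càdlàg local martingale with $M_0=0$ and $A$ is an adapted càdlàg predictable process of finite variation with $A_{0-}=A_0=0$. $X_{t-}$ is the left limit of $X$ at $t>0$ and $X_{0-}=X_0$. Class $(\Sigma^{g})$: $X$ is of class $(\Sigma^{g})$ if it decomposes as $X=M+A$ with $M$ a càdlàg local martingale, $M_0=0$; $A$ an adapted càdlàg predictable process of finite variation with $A_{0-}=A_0=0$; and $\int_{0}^{t}1_{\{X_{s}X_{s-}\neq0\}}dA_{s}=0$ for all $t\geq0$. Integrals with respect to $dA$, $dC$, $dV$ are Lebesgue–Stieltjes integrals, so $C$ and $V$ are understood to be càdlàg of finite variation. *)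

(* Defs.v *)
From HB Require Import structures.
From mathcomp Require Import all_boot all_order all_algebra.
From mathcomp Require Import all_classical all_reals all_analysis.

Set Implicit Arguments.
Unset Strict Implicit.
Unset Printing Implicit Defensive.

Import Order.TTheory GRing.Theory Num.Theory.
Import numFieldNormedType.Exports.

Local Open Scope classical_set_scope.
Local Open Scope ring_scope.

(* Time is the half-line [0, +oo[ of R: processes and filtrations are indexed
   by R, and their values at negative indices are never used. Path regularity
   is required of every path; identities between processes (and the vanishing
   of the integrals) are required outside a null set common to all times. *)

Section paths.
Context {R : realType}.
Implicit Types (g h : R -> R) (s t v : R).

Definition cadlag_path g : Prop :=
  (forall t, 0 <= t -> g s @[s --> t^'+] --> g t) /\
  (forall t, 0 < t -> cvg (g s @[s --> t^'-])).

Definition finite_variation_path g : Prop :=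
  forall t, 0 <= t -> bounded_variation 0 t g.

Definition left_limit g t : R :=
  if t <= 0 then g 0 else lim (g s @[s --> t^'-]).

(* [LS_integral g h t v]: h is integrable against dg over ]0, t], with
   Lebesgue-Stieltjes integral v. Here dg is the signed measure dF - dG for any
   decomposition of g on [0, +oo[ as a difference of nondecreasing
   right-continuous functions; one exists when g is cadlag of finite variation,
   and v does not depend on which one is chosen. *)
Definition LS_integral g h t v : Prop :=
  exists F G : cumulative R R,
    [/\ forall s, 0 <= s -> g s = F s - G s,
        (lebesgue_stieltjes_measure F).-integrable `]0, t] (EFin \o h),
        (lebesgue_stieltjes_measure G).-integrable `]0, t] (EFin \o h) &
        v = (\int[lebesgue_stieltjes_measure F]_(s in `]0, t]) h s)
            - (\int[lebesgue_stieltjes_measure G]_(s in `]0, t]) h s)].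

End paths.

Section processes.
Context {d : measure_display} {T : measurableType d} {R : realType}.
Variables (P : probability T R) (F : R -> set (set T)).
Implicit Types (X M A : R -> T -> R) (Y Z : T -> R) (G : set (set T)).

Definition filtration : Prop :=
  [/\ forall t, 0 <= t -> sigma_algebra setT (F t),
      forall t, 0 <= t -> F t `<=` measurable &
      forall s t, 0 <= s -> s <= t -> F s `<=` F t].

Definition usual_conditions : Prop :=
  [/\ filtration,
      forall t, 0 <= t -> F t = \bigcap_(s in `]t, +oo[) F s &
      forall N, P.-negligible N -> F 0 N].

Definition measurable_wrt G Z : Prop :=
  forall B : set R, measurable B -> G (Z @^-1` B).

Definition adapted X : Prop :=
  forall t, 0 <= t -> measurable_wrt (F t) (X t).

Definition cadlag X : Prop := forall w, cadlag_path (X ^~ w).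

Definition finite_variation X : Prop :=
  forall w, finite_variation_path (X ^~ w).

Definition predictable_sigma_algebra : set (set (R * T)) :=
  <<s `[0, +oo[ `*` setT,
      [set [set 0] `*` B | B in F 0] `|`
      [set H | exists s t B,
        [/\ 0 <= s, s < t, F s B & H = `]s, t] `*` B]] >>.

Definition predictable X : Prop :=
  forall B : set R, measurable B ->
    predictable_sigma_algebra
      ((`[0, +oo[ `*` setT) `&` (fun p => X p.1 p.2) @^-1` B).

(* Z is a version of E[Y | G]. *)
Definition is_cond_exp G Y Z : Prop :=
  [/\ measurable_wrt G Z,
      P.-integrable setT (EFin \o Z) &
      forall B, G B ->
        (\int[P]_(w in B) (Z w)%:E = \int[P]_(w in B) (Y w)%:E)%E].

Definition martingale M : Prop :=
  [/\ adapted M,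
      forall t, 0 <= t -> P.-integrable setT (EFin \o M t) &
      forall s t, 0 <= s -> s <= t -> is_cond_exp (F s) (M t) (M s)].

Definition stopping_time (tau : T -> \bar R) : Prop :=
  (forall w, (0 <= tau w)%E) /\
  (forall t, 0 <= t -> F t [set w | (tau w <= t%:E)%E]).

Definition stopped X (tau : T -> \bar R) : R -> T -> R :=
  fun t w => X (fine (Order.min t%:E (tau w))) w.

(* The stopped processes need no centring at time 0, since this is only applied
   to processes started at 0. *)
Definition local_martingale M : Prop :=
  [/\ adapted M, cadlag M &
      exists tau : nat -> T -> \bar R,
        [/\ forall n, stopping_time (tau n),
            {ae P, forall w, nondecreasing_seq (tau ^~ w)},
            {ae P, forall w, tau n w @[n --> \oo] --> +oo%E} &
            forall n, martingale (stopped M (tau n))]].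

(* X = M + A is a cadlag semimartingale. The value A_{0-} is by convention A_0,
   as in [left_limit]. *)
Definition semimartingale_decomposition X M A : Prop :=
  [/\ adapted X, cadlag X &
      {ae P, forall w, forall t, 0 <= t -> X t w = M t w + A t w}] /\
  [/\ local_martingale M & {ae P, forall w, M 0 w = 0}] /\
  [/\ adapted A, predictable A, cadlag A, finite_variation A &
      {ae P, forall w, A 0 w = 0}].

Definition class_Sigma_g X : Prop :=
  exists M A, semimartingale_decomposition X M A /\
    {ae P, forall w, forall t, 0 <= t ->
      LS_integral (A ^~ w)
        (fun s => (X s w * left_limit (X ^~ w) s != 0)%:R) t 0}.

End processes.

(* Main.v *)
Require Import Defs.
From HB Require Import structures.
From mathcomp Require Import all_boot all_order all_algebra.
From mathcomp Require Import all_classical all_reals all_analysis.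
From mathcomp Require Import measurable_realfun ring lra.

Set Implicit Arguments.
Unset Strict Implicit.
Unset Printing Implicit Defensive.

Import Order.TTheory GRing.Theory Num.Theory.
Import numFieldNormedType.Exports.

Local Open Scope classical_set_scope.
Local Open Scope ring_scope.

(** The indicator of X X_- <> 0 is the product of the two indicators in the
    splitting A = C + V, and both directions rest on it.

    From a splitting to the class, the argument is made path by path. The
    integral of an indicator is the value of the signed measure of the path,
    called [charge] below, on the indicated set ([LS_integral_charge]). When the
    integral of 1_{X <> 0} against dC vanishes on every ]0, t], the signed
    measure 1_{X <> 0} dC is zero, so it remains zero after multiplication by
    1_{X_- <> 0}. The same holds for 1_{X_- <> 0} dV multiplied by 1_{X <> 0},
    and the two add up to 1_{X X_- <> 0} dA ([LS_integral_sum]).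

    Conversely let Q be the set where X_- <> 0, and let C and V be the integrals
    of 1_Q and of 1 - 1_Q against dA. Then dV is carried by the set where X_- =
    0, and 1_{X <> 0} dC = 1_{X X_- <> 0} dA. The set Q is predictable because
    X_- is a limit of left-continuous step processes ([predictable_left_limit]);
    C and V are predictable by a Dynkin class argument on Q
    ([predictable_charge]).

    The class only says that dA' vanishes where X X_- <> 0 for some
    decomposition X = M' + A', which need not be the given one. The converse
    therefore needs the uniqueness of the predictable part: a predictable
    process D of finite variation, null at 0, which is almost surely a
    difference of local martingales, here D = A' - A = M - M', is almost surely
    zero ([predictable_local_martingale_zero]).

    Stop at a bounded time rho that reduces both local martingales and comes no
    later than the first time the variation of D reaches a level c. Optional
    stopping ([optional_stopping]) says that the increments of D up to rho have
    mean zero on past events, and a Dynkin class argument extends this to the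
    integral over ]0, rho] of 1_S against dD, for every predictable set S
    ([expectation_charge]). Take phi x = x ^+ 2 / (1 + x ^+ 2). By [chain_rule],
    phi (D_rho) - phi (D_0) is the integral of a difference quotient of phi at
    D_- and D. That integrand is bounded, and it is predictable precisely
    because D is; slicing it into level sets ([quantized_chain_rule]) gives E
    [phi (D_rho)] = 0 ([expectation_phi]). Since phi is nonnegative and vanishes
    only at 0, D_rho = 0 almost surely. Letting the level and the reducing times
    grow gives D = 0 on dyadic times, and right continuity does the rest.

    The stopping time rho does not control the jump of D at rho itself. That
    jump is bounded by |D_rho - D_0| plus the variation before rho
    ([stieltjes_bound]), and D_rho is integrable by optional stopping; this is
    why phi is chosen with a bounded difference quotient. *)

Local Notation LS := lebesgue_stieltjes_measure.

(** * The signed measure of a path *)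

Section stieltjes.
Context {R : realType}.
Implicit Types (f g h : R -> R) (F G : cumulative R R) (K L : set (measurableTypeR R)).

Lemma LS_itv F a b : a <= b -> LS F `]a, b] = (F b - F a)%:E.
Proof.
move=> ab; rewrite /lebesgue_stieltjes_measure/= /measure_extension measurable_mu_extE/=; last exact: is_ocitv.
exact: wlength_itv_bnd.
Qed.

Lemma LS_fin F t K : measurable K -> LS F (K `&` `]0%R, t]%classic) \is a fin_num.
Proof.
move=> mK; have [t0|t0] := leP 0 t; last first.
  by rewrite set_itv_ge ?setI0 ?measure0// bnd_simp -leNgt ltW.
rewrite ge0_fin_numE ?measure_ge0//.
rewrite (@le_lt_trans _ _ (LS F `]0%R, t]%classic))//; last by rewrite LS_itv// ltry.
by rewrite le_measure ?inE//=; exact: measurableI.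
Qed.

(** The half-open intervals form a pi-system generating the Borel sets; both
    measures are restricted to ]0, t] because they may differ on the negative
    half-line. *)
Lemma eq_measure_itv (m1 m2 : {measure set (measurableTypeR R) -> \bar R}) :
  (forall a b : R, 0 <= a -> a <= b -> m1 `]a, b]%classic = m2 `]a, b]%classic) ->
  (forall b : R, 0 <= b -> (m1 `]0%R, b]%classic < +oo)%E) ->
  forall t K, measurable K -> m1 (K `&` `]0%R, t]%classic) = m2 (K `&` `]0%R, t]%classic).
Proof.
move=> m12 m1oo t K mK.
have [t0|t0] := leP 0 t; last first.
  by rewrite set_itv_ge ?setI0 ?measure0// bnd_simp -leNgt ltW.
have mt : measurable (`]0, t] : set (measurableTypeR R)) by exact: measurable_itv.
apply: (@measure_unique _ R (measurableTypeR R) (@ocitv R)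
  (fun k : nat => `]- k%:R, k%:R]%classic) _ _ _ _
  (mrestr m1 mt) (mrestr m2 mt)) => //.
- exact: ocitvI.
- by move=> i; exact: is_ocitv.
- apply/seteqP; split=> // x _; exists (Num.truncn `|(x : R)|).+1 => //=.
  have := truncnS_gt `|(x : R)|.
  rewrite ltr_norml => /andP[xn1 xn2].
  by rewrite in_itv/= xn1 ltW.
- move=> A [[a b] _ <-] /=; rewrite /mrestr.
  have -> : `]a, b] `&` `]0, t] = `](Num.max a 0), (Num.min b t)]%classic.
    apply/seteqP; split=> x /=; rewrite !in_itv/= gt_max le_min.
      by move=> [/andP[-> ->] /andP[-> ->]].
    by move=> /andP[/andP[-> ->] /andP[-> ->]].
  have [ab|ab] := leP (Num.max a 0) (Num.min b t); last first.
    by rewrite set_itv_ge ?measure0// bnd_simp -leNgt ltW.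
  by apply: m12 => //; rewrite le_max lexx orbT.
- move=> k; rewrite (@le_lt_trans _ _ (m1 `]0%R, t]%classic))//; last exact: m1oo.
  rewrite /= /mrestr; apply: le_measure; rewrite ?inE//; first apply: measurableI => //; exact: measurable_itv.
Qed.

Definition decomposes f F G := forall s, 0 <= s -> f s = F s - G s.

(** The signed measure dF - dG restricted to ]0, t]. Both terms are finite
    there, so the difference is meaningful for every Borel set. *)
Definition charge F G t K : R :=
  fine (LS F (K `&` `]0%R, t]%classic)) - fine (LS G (K `&` `]0%R, t]%classic)).

Lemma charge_itv f F G t a b : decomposes f F G -> 0 <= a -> a <= b -> 0 <= t ->
  charge F G t `]a, b] = f (Num.min b t) - f (Num.min a t).
Proof.
move=> fFG a0 ab t0; rewrite /charge.
have -> : `]a, b] `&` `]0, t] = `](Num.min a t), (Num.min b t)]%classic.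
  apply/seteqP; split=> x /=; rewrite !in_itv/= gt_min le_min.
    by move=> [/andP[-> ->] /andP[_ ->]].
  move=> /andP[/orP[ax|tx] /andP[xb xt]]; first by rewrite ax xb xt (le_lt_trans a0 ax).
  by move: (lt_le_trans tx xt); rewrite ltxx.
have mm : Num.min a t <= Num.min b t.
  by rewrite le_min !ge_min ab lexx orbT.
rewrite !LS_itv//= !fFG//; first by lra.
  by rewrite le_min a0.
by rewrite le_min t0 (le_trans a0).
Qed.

(** Comparing F + G' with F' + G avoids subtracting measures: both sums are
    positive measures, with the same increments on [0, +oo[. *)
Lemma decomposition_agree f F G F' G' K t :
  decomposes f F G -> decomposes f F' G' -> measurable K ->
  (LS F (K `&` `]0%R, t]%classic) + LS G' (K `&` `]0%R, t]%classic) =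
   LS F' (K `&` `]0%R, t]%classic) + LS G (K `&` `]0%R, t]%classic))%E.
Proof.
move=> fFG fFG' mK.
pose m1 : {measure set (measurableTypeR R) -> \bar R} := measure_add (LS F) (LS G').
pose m2 : {measure set (measurableTypeR R) -> \bar R} := measure_add (LS F') (LS G).
have m1E A : m1 A = (LS F A + LS G' A)%E by exact: measure_addE.
have m2E A : m2 A = (LS F' A + LS G A)%E by exact: measure_addE.
rewrite -m1E -m2E; apply: eq_measure_itv => //.
- move=> a b a0 ab; rewrite m1E m2E !LS_itv// -!EFinD; congr EFin.
  by move: (fFG a a0) (fFG' a a0) (fFG b (le_trans a0 ab)) (fFG' b (le_trans a0 ab)); lra.
- by move=> b b0; rewrite m1E !LS_itv// -EFinD ltry.
Qed.

Lemma charge_unique f F G F' G' K t :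
  decomposes f F G -> decomposes f F' G' -> measurable K ->
  charge F G t K = charge F' G' t K.
Proof.
move=> fFG fFG' mK; have := decomposition_agree t fFG fFG' mK.
rewrite -[LS F _]fineK ?LS_fin// -[LS F' _]fineK ?LS_fin//.
rewrite -[LS G _]fineK ?LS_fin// -[LS G' _]fineK ?LS_fin//.
by rewrite -!EFinD => -[]; rewrite /charge; lra.
Qed.

End stieltjes.

(** * Integrals of indicators *)

Section charge_integral.
Context {R : realType}.
Implicit Types (f g h : R -> R) (F G H : cumulative R R) (K L : set (measurableTypeR R)).

Lemma cumulative_of f : {homo f : x y / x <= y} -> (forall x, f @ x^'+ --> f x) ->
  exists F : cumulative R R, F =1 f.
Proof.
move=> nd rc.
pose F : cumulative R R := HB.pack f (@isCumulative.phant_Build R _ R f nd rc).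
by exists F.
Qed.

Lemma cumulative_sum F G : exists H : cumulative R R, forall x, H x = F x + G x.
Proof.
apply: (@cumulative_of (fun x => F x + G x)) => [x y xy|x].
  by rewrite lerD//; exact: cumulative_is_nondecreasing.
by apply: cvgD; exact: cumulative_is_right_continuous.
Qed.

Lemma LS_sum F G H t K : (forall x, H x = F x + G x) -> measurable K ->
  (LS H (K `&` `]0%R, t]%classic) =
   LS F (K `&` `]0%R, t]%classic) + LS G (K `&` `]0%R, t]%classic))%E.
Proof.
move=> HFG mK.
pose m : {measure set (measurableTypeR R) -> \bar R} := measure_add (LS F) (LS G).
have mE A : m A = (LS F A + LS G A)%E by exact: measure_addE.
rewrite -mE; apply: eq_measure_itv => //.
- move=> a b a0 ab; rewrite mE [LHS](LS_itv H ab) !LS_itv// -EFinD !HFG.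
  by congr EFin; lra.
- by move=> b b0; rewrite [ltLHS](LS_itv H b0) ltry.
Qed.

Lemma charge_sum F G F' G' (F2 G2 : cumulative R R) t K : (forall x, F2 x = F x + F' x) ->
  (forall x, G2 x = G x + G' x) -> measurable K ->
  charge F2 G2 t K = charge F G t K + charge F' G' t K.
Proof.
move=> hF hG mK; rewrite /charge (LS_sum t hF mK) (LS_sum t hG mK).
rewrite !fineD ?LS_fin//; lra.
Qed.

Lemma bounded_on_le (T : Type) (D : set T) (h : T -> R) c :
  (forall x, D x -> `|h x| <= c) -> [bounded h x | x in D].
Proof.
move=> hc; exists c; split; first exact: num_real.
by move=> y /ltW cy x Dx; exact: le_trans (hc x Dx) cy.
Qed.

Lemma indicator_integral F t (b : R -> bool) :
  measurable ([set s | b s] `&` `]0, t] : set (measurableTypeR R)) ->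
  (LS F).-integrable `]0, t] (EFin \o (fun s => (b s)%:R)) /\
  \int[LS F]_(s in `]0, t]) (b s)%:R = fine (LS F ([set s | b s] `&` `]0, t])).
Proof.
set K := _ `&` _ => mK.
have mt : measurable (`]0, t] : set (measurableTypeR R)) by exact: measurable_itv.
pose k : measurableTypeR R -> R := \1_K.
have EK : {in `]0, t]%classic, (fun s => (b s)%:R) =1 k}.
  move=> s; rewrite inE/= => st; rewrite /k indicE.
  suff -> : b s = (s \in K) by [].
  by apply/idP/idP; rewrite inE /K/=; [|case].
split.
  apply: (@eq_integrable _ _ _ _ _ mt (EFin \o k)).
    by move=> s /EK /= ->.
  apply: measurable_bounded_integrable => //.
  - have := @LS_fin _ F t setT measurableT.
    by rewrite setTI fin_numElt => /andP[].
  - exact: measurable_indic.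
  - apply: (bounded_on_le (c := 1)) => s _; rewrite /k indicE.
    by case: (_ \in _); rewrite ?normr1 ?normr0.
rewrite /Rintegral (eq_integral (EFin \o k)) => [|s /EK /= -> //].
by rewrite /= integral_indic// /K -setIA setIid.
Qed.

Lemma charge_itvI F G t K : charge F G t (K `&` `]0, t]) = charge F G t K.
Proof. by rewrite /charge -setIA setIid. Qed.

(** The decomposition hidden in the integral is traded for a fixed one, since
    the signed measure does not depend on it. The integrability clause accounts
    for the measurability of the indicated set. *)
Lemma LS_integral_charge g F G (b : R -> bool) t v : decomposes g F G ->
  LS_integral g (fun s => (b s)%:R) t v <->
  measurable ([set s | b s] `&` `]0, t] : set (measurableTypeR R)) /\
  v = charge F G t [set s | b s].
Proof.
move=> gFG; split=> [[F' [G' [gFG' iF iG ->]]]|[mb ->]]; last first.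
  have [iF EF] := indicator_integral F mb; have [iG EG] := indicator_integral G mb.
  by exists F, G; split => //; rewrite EF EG.
have mb : measurable ([set s | b s] `&` `]0, t] : set (measurableTypeR R)).
  have /integrableP[/measurable_EFinP mf _] := iF.
  have := mf (measurable_itv _) [set 1] (measurable_set1 _).
  rewrite setIC; congr (measurable (_ `&` _)); apply/seteqP; split=> s /=.
    by case: (b s) => // /eqP; rewrite eq_sym oner_eq0.
  by move=> ->.
split=> //; have [_ ->] := indicator_integral F' mb; have [_ ->] := indicator_integral G' mb.
have := @charge_unique _ g F G F' G' ([set s | b s] `&` `]0, t]) t gFG gFG' mb.
by rewrite /charge -setIA setIid => ->.
Qed.

(** The signed measure 1_K (dF - dG) vanishes on the intervals ]0, t], hence on
    all ]a, b] by difference, so the measures 1_K dF and 1_K dG agree on Borel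
    sets. *)
Lemma charge_eq0_sub F G K :
  (forall t, 0 <= t -> measurable (K `&` `]0, t] : set (measurableTypeR R))) ->
  (forall t, 0 <= t -> charge F G t K = 0) ->
  forall t L, measurable L -> charge F G t (K `&` L) = 0.
Proof.
move=> mK K0 t L mL.
(* Only the positive part of K is known to be Borel. *)
pose K' : set (measurableTypeR R) := K `&` `]0, +oo[.
have mK' : measurable K'.
  rewrite /K' (_ : `]0, +oo[%classic = \bigcup_n `]0, n%:R]%classic); last first.
    apply/seteqP; split=> x /=; rewrite in_itv/=.
      rewrite andbT => x0; exists (Num.truncn x).+1 => //=.
      by rewrite in_itv/= x0 ltW//= truncnS_gt.
    by move=> [n _] /=; rewrite in_itv/= => /andP[->].
  rewrite setI_bigcupr; apply: bigcup_measurable => n _.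
  exact: mK.
have KK' s A : K `&` (A `&` `]0, s]%classic) = K' `&` (A `&` `]0, s]%classic).
  apply/seteqP; split=> [x [Kx [Ax xs]]|x [[Kx _] Axs]]; last by split.
  split; last by split.
  by split => //; move: xs; rewrite /= !in_itv/= => /andP[->].
pose m1 : {measure set (measurableTypeR R) -> \bar R} := mrestr (LS F) mK'.
pose m2 : {measure set (measurableTypeR R) -> \bar R} := mrestr (LS G) mK'.
have finK (H : cumulative R R) s : 0 <= s -> LS H (K `&` `]0%R, s]%classic) \is a fin_num.
  move=> s0; have := LS_fin H s (mK s s0).
  by rewrite -setIA setIid.
have E : m1 (L `&` `]0%R, t]%classic) = m2 (L `&` `]0%R, t]%classic).
  have EQ s : 0 <= s -> LS F (K `&` `]0%R, s]%classic) = LS G (K `&` `]0%R, s]%classic).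
    move=> s0; have /eqP := K0 s s0; rewrite subr_eq0 => /eqP.
    by move=> E; rewrite -[LHS]fineK ?finK// E fineK ?finK.
  apply: eq_measure_itv => //.
  - move=> a b a0 ab; rewrite /= /mrestr/=.
    have -> : `]a, b]%classic `&` K' = (K `&` `]0, b]%classic) `\` (K `&` `]0, a]%classic).
      apply/seteqP; split=> x.
        move=> [/=]; rewrite in_itv/= => /andP[ax xb] [Kx].
        rewrite /= in_itv/= andbT => x0; split.
          by split => //=; rewrite in_itv/= x0 xb.
        by move=> [_] /=; rewrite in_itv/= => /andP[_]; rewrite leNgt ax.
      move=> [[Kx] /=]; rewrite in_itv/= => /andP[x0 xb] H.
      split; last by split => //=; rewrite in_itv/= x0.
      rewrite /= in_itv/= xb andbT ltNge; apply/negP => xa; apply: H.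
      by split => //=; rewrite in_itv/= x0 xa.
    have S : K `&` `]0, a]%classic `<=` K `&` `]0, b]%classic.
      by move=> x /= [Kx]; rewrite !in_itv/= => /andP[-> /le_trans ->].
    have b0 := le_trans a0 ab.
    have D (H : cumulative R R) :
        LS H ((K `&` `]0%R, b]%classic) `\` (K `&` `]0%R, a]%classic)) =
        (LS H (K `&` `]0%R, b]%classic) - LS H (K `&` `]0%R, a]%classic))%E.
      have SI := setIidr S.
      rewrite measureD ?SI//; try exact: mK.
      by have := finK H b b0; rewrite ge0_fin_numE ?measure_ge0.
    by rewrite [LHS]D [RHS]D !EQ.
  - move=> b b0; apply: (@le_lt_trans _ _ (LS F `]0%R, b]%classic)).
      apply: (measureIl (LS F)) => //; exact: measurable_itv.
    by rewrite LS_itv// ltry.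
rewrite /charge -!setIA !KK'; move: E; rewrite /m1 /m2/= /mrestr/= => E.
by rewrite ![K' `&` _]setIC E subrr.
Qed.

Lemma LS_integral_decomposes g h t v : LS_integral g h t v -> exists F G, decomposes g F G.
Proof. by move=> [F [G [gFG _ _ _]]]; exists F, G. Qed.

(** Each of the two signed measures 1_p dc and 1_q dv is zero, so it remains
    zero when multiplied by the other indicator. *)
Lemma LS_integral_sum (a c v : R -> R) (p q : R -> bool) :
  (forall t, 0 <= t -> a t = c t + v t) ->
  (forall t, 0 <= t -> LS_integral c (fun s => (p s)%:R) t 0) ->
  (forall t, 0 <= t -> LS_integral v (fun s => (q s)%:R) t 0) ->
  forall t, 0 <= t -> LS_integral a (fun s => (p s && q s)%:R) t 0.
Proof.
move=> acv hc hv t t0.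
have [F [G cFG]] := LS_integral_decomposes (hc 0 (lexx _)).
have [F' [G' vFG]] := LS_integral_decomposes (hv 0 (lexx _)).
have [F2 F2E] := cumulative_sum F F'; have [G2 G2E] := cumulative_sum G G'.
have aFG : decomposes a F2 G2.
  by move=> s s0; rewrite acv// cFG// vFG// F2E G2E; lra.
pose P := [set s | p s]; pose Q := [set s | q s].
have mP s : 0 <= s -> measurable (P `&` `]0, s] : set (measurableTypeR R)).
  by move=> s0; have /(LS_integral_charge _ _ _ cFG)[] := hc s s0.
have mQ s : 0 <= s -> measurable (Q `&` `]0, s] : set (measurableTypeR R)).
  by move=> s0; have /(LS_integral_charge _ _ _ vFG)[] := hv s s0.
have P0 s : 0 <= s -> charge F G s P = 0.
  by move=> s0; have /(LS_integral_charge _ _ _ cFG)[_ <-] := hc s s0.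
have Q0 s : 0 <= s -> charge F' G' s Q = 0.
  by move=> s0; have /(LS_integral_charge _ _ _ vFG)[_ <-] := hv s s0.
have EPQ : [set s | p s && q s] `&` `]0, t] = (P `&` `]0, t]) `&` (Q `&` `]0, t]).
  apply/seteqP; split=> s; first by move=> [/andP[Ps Qs] st].
  by move=> [[Ps st] [Qs _]]; split => //; apply/andP.
have mPQ := measurableI _ _ (mP t t0) (mQ t t0).
apply/(LS_integral_charge _ _ _ aFG); rewrite EPQ; split=> //.
rewrite -charge_itvI EPQ.
rewrite (charge_sum t F2E G2E mPQ).
have E1 : (P `&` `]0, t]) `&` (Q `&` `]0, t]) = P `&` (Q `&` `]0, t]).
  by rewrite -!setIA (setICA `]0, t]%classic) setIid.
have E2 : P `&` (Q `&` `]0, t]) = Q `&` (P `&` `]0, t]) by rewrite setICA.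
rewrite E1 (charge_eq0_sub mP P0 t (mQ t t0)) E2.
by rewrite (charge_eq0_sub mQ Q0 t (mP t t0)) addr0.
Qed.

End charge_integral.

(** * Paths of finite variation *)

Section paths.
Context {R : realType}.
Implicit Types (f g h : R -> R) (F G H : cumulative R R) (K L : set (measurableTypeR R)).

Lemma variation_le_increment a b f g s : itv_partition a b s ->
  (forall x y, a <= x -> x <= y -> y <= b -> `|f y - f x| <= g y - g x) ->
  variation a b f s <= g b - g a.
Proof.
move=> abs fg; rewrite /variation /=.
have -> : g b - g a = \sum_(0 <= n < size s) (g (nth b (a :: s) n.+1) - g (nth b (a :: s) n)).
  by rewrite (telescope_sumr (fun n => g (nth b (a :: s) n)))// (itv_partition_nth_size b abs).
rewrite !big_nat; apply: ler_sum => n ns; apply: fg.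
- by apply: itv_partition_nth_ge abs; exact: ltnW.
- have := @nondecreasing_fun_itv_partition _ _ a b id s _ abs n ns.
  by apply => x y.
- exact: (@itv_partition_nth_le _ _ a b s n.+1).
Qed.

Lemma right_continuous_clamp g : (forall t, 0 <= t -> g @ t^'+ --> g t) ->
  forall x, (fun y => g (Num.max y 0)) @ x^'+ --> g (Num.max x 0).
Proof.
move=> grc x; have [x0|x0] := leP 0 x.
  apply: cvg_trans (grc x x0); apply: near_eq_cvg; near=> y.
  by rewrite max_l// (le_trans x0)//; near: y; exact: nbhs_right_ge.
apply: cvg_near_cst; near=> y; congr g.
by rewrite max_r//; near: y; exact: nbhs_right_le.
Unshelve. all: by end_near. Qed.

(** An increment of f dominated by an increment of g tends to zero with it. *)
Lemma right_continuous_le f g x :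
  (forall y, x <= y -> 0 <= f y - f x <= g y - g x) ->
  g @ x^'+ --> g x -> f @ x^'+ --> f x.
Proof.
move=> fg gx.
have gx' : (fun y => f x + (g y - g x)) @ x^'+ --> f x.
  rewrite -[X in _ --> X]addr0 -(subrr (g x)).
  by apply: cvgD; [exact: cvg_cst|apply: cvgB => //; exact: cvg_cst].
apply: (@squeeze_cvgr _ _ _ _ (cst (f x)) (fun y => f x + (g y - g x))) => //; last exact: cvg_cst.
near=> y; have xy : x <= y by near: y; exact: nbhs_right_ge.
by have /andP[] := fg y xy; rewrite /=; lra.
Unshelve. all: by end_near. Qed.

Lemma decomposes_cadlag f F G : decomposes f F G -> cadlag_path f.
Proof.
move=> fFG; split=> t t0.
  rewrite fFG//; apply: (@cvg_trans _ ((fun s => F s - G s) @ t^'+)).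
    apply: near_eq_cvg; near=> s; rewrite fFG// (le_trans t0)//.
  by apply: cvgB; exact: cumulative_is_right_continuous.
have lF H : cvg (H s @[s --> t^'-]).
  apply: nondecreasing_at_left_is_cvgr.
    by near=> x; move=> u v _ _; exact: cumulative_is_nondecreasing.
  near=> x; exists (H t) => _ [y /= + <-]; rewrite in_itv/= => /andP[_ yt].
  by apply: cumulative_is_nondecreasing; exact: ltW.
apply/cvg_ex; exists (lim (F @ t^'-) - lim (G @ t^'-)).
apply: (@cvg_trans _ ((fun s => F s - G s) @ t^'-)); last first.
  by apply: cvgB; exact: lF.
apply: near_eq_cvg; near=> s; rewrite fFG//.
by apply: ltW; near: s; exact: nbhs_left_gt.
Unshelve. all: by end_near. Qed.

Lemma decomposes_finite_variation f F G : decomposes f F G -> finite_variation_path f.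
Proof.
move=> fFG t t0; exists ((F t + G t) - (F 0 + G 0)) => _ [s st <-].
apply: (variation_le_increment (g := fun x => F x + G x) st) => x y x0 xy yt.
have Fxy := cumulative_is_nondecreasing F x y xy.
have Gxy := cumulative_is_nondecreasing G x y xy.
by rewrite !fFG ?(le_trans x0)// ler_norml; apply/andP; split; move: Fxy Gxy; lra.
Qed.

Lemma total_variation_increment f x y : finite_variation_path f -> 0 <= x -> x <= y ->
  `|f y - f x| <= fine (total_variation 0 y f) - fine (total_variation 0 x f).
Proof.
move=> fv x0 xy.
have y0 := le_trans x0 xy.
have fy : total_variation 0 y f \is a fin_num by apply/bounded_variationP => //; exact: fv.
have fx : total_variation 0 x f \is a fin_num by apply/bounded_variationP => //; exact: fv.
have := total_variation_ge f xy; have E := total_variationD f x0 xy.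
have fxy : total_variation x y f \is a fin_num.
  by move: fy; rewrite E fin_numD => /andP[].
rewrite E fineD// addrAC subrr add0r.
by rewrite -[X in (_ <= X)%E -> _]fineK.
Qed.

(** Taking the total variation itself as the first component makes one adapted
    process control both measures. *)
Lemma jordan_decomposition f : cadlag_path f -> finite_variation_path f ->
  exists F G, decomposes f F G /\
    forall s, 0 <= s -> F s = fine (total_variation 0 s f).
Proof.
move=> [frc _] fv.
pose V t := fine (total_variation 0 t f).
have Vrc t : 0 <= t -> V @ t^'+ --> V t.
  move=> t0; have tt1 : t < t + 1 by rewrite ltrDl.
  apply: (total_variation_right_continuous t0 tt1) => //; first exact: frc.
  by apply: fv; rewrite addr_ge0.
have mm x y : x <= y -> Num.max x 0 <= Num.max y (0 : R).
  by move=> xy; rewrite ge_max !le_max xy lexx orbT.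
have m0 x : 0 <= Num.max x (0 : R) by rewrite le_max lexx orbT.
have [F FE] : exists F : cumulative R R, F =1 (fun x => V (Num.max x 0)).
  apply: cumulative_of => [x y xy|]; last exact: right_continuous_clamp.
  rewrite -subr_ge0; apply: le_trans (total_variation_increment fv (m0 x) (mm _ _ xy)).
  exact: normr_ge0.
have [G GE] : exists G : cumulative R R, G =1 (fun x => V (Num.max x 0) - f (Num.max x 0)).
  apply: cumulative_of => [x y xy|x].
    have := total_variation_increment fv (m0 x) (mm _ _ xy); rewrite -/(V _) -/(V _).
    have := ler_norm (f (Num.max y 0) - f (Num.max x 0)); lra.
  by apply: cvgB; [exact: (right_continuous_clamp Vrc)|exact: (right_continuous_clamp frc)].
exists F, G; split=> s s0; rewrite FE ?GE max_l//; lra.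
Qed.

(** The distribution function of 1_K dF is dominated in increments by that of
    dF, whence its right continuity. *)
Lemma cut_cumulative F K : measurable K ->
  exists F' : cumulative R R, forall x, F' x = fine (LS F (K `&` `]0%R, x]%classic)).
Proof.
move=> mK; pose f x := fine (LS F (K `&` `]0%R, x]%classic)).
have inc x y : x <= y -> 0 <= f y - f x <= F (Num.max y 0) - F (Num.max x 0).
  move=> xy.
  have mx0 : Num.max x 0 <= Num.max y 0 by rewrite ge_max !le_max xy lexx orbT.
  have mKi (i : interval R) : measurable (K `&` [set` i]).
    by apply: measurableI => //; exact: measurable_itv.
  have sub : K `&` `]0, x]%classic `<=` K `&` `]0, y]%classic.
    by move=> z [Kz] /=; rewrite !in_itv/= => /andP[-> /le_trans ->].
  pose B := (K `&` `]0, y]%classic) `\` (K `&` `]0, x]%classic).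
  have D : LS F (K `&` `]0%R, y]%classic) = (LS F (K `&` `]0%R, x]%classic) + LS F B)%E.
    rewrite -measureU//; [|exact: measurableD|].
      by rewrite /B setDUK.
    by rewrite /B setDE setICA setICr setI0.
  have mB : measurable B by exact: measurableD.
  have Bsub : B `<=` `](Num.max x 0), (Num.max y 0)]%classic.
    move=> z [[Kz]] /=; rewrite !in_itv/= gt_max le_max => /andP[z0 zy] H.
    rewrite z0 zy !andbT ltNge; apply/negP => zx; apply: H; split => //.
    by rewrite z0 zx.
  have B1 : (LS F B <= (F (Num.max y 0) - F (Num.max x 0))%:E)%E.
    by rewrite -LS_itv//; apply: le_measure => //; rewrite inE//; exact: measurable_itv.
  have B2 : (0 <= LS F B)%E by exact: measure_ge0.
  have Bf : LS F B \is a fin_num by rewrite ge0_fin_numE// (le_lt_trans B1)// ltry.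
  rewrite /f D fineD// ?LS_fin// addrAC subrr add0r fine_ge0//=.
  by rewrite -lee_fin fineK.
apply: (@cumulative_of _ f) => [x y xy|x].
  by rewrite -subr_ge0; case/andP: (inc x y xy).
(* Clamping at 0 matches ]0, x], which is empty for negative x. *)
apply: (right_continuous_le (g := fun x => F (Num.max x 0))); first exact: inc.
by apply: right_continuous_clamp => t _; exact: cumulative_is_right_continuous.
Qed.

Lemma LS_cut F F' K : measurable K ->
  (forall x, F' x = fine (LS F (K `&` `]0%R, x]%classic))) ->
  forall t L, measurable L ->
  LS F' (L `&` `]0%R, t]%classic) = LS F (K `&` L `&` `]0%R, t]%classic).
Proof.
move=> mK FE t L mL.
pose m : {measure set (measurableTypeR R) -> \bar R} := mrestr (LS F) mK.
have mE A : m A = LS F (A `&` K) by [].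
have -> : K `&` L `&` `]0%R, t]%classic = L `&` `]0%R, t]%classic `&` K.
  by rewrite -setIA setIC.
rewrite -mE; apply: (@eq_measure_itv _ (LS F') m) => //; last first.
  by move=> b b0; rewrite [ltLHS](LS_itv F' b0) ltry.
move=> a b a0 ab; rewrite mE [LHS](LS_itv F' ab) !FE.
have sub : K `&` `]0, a]%classic `<=` K `&` `]0, b]%classic.
  by move=> z [Kz] /=; rewrite !in_itv/= => /andP[-> /le_trans ->].
have mKi (i : interval R) : measurable (K `&` [set` i]).
  by apply: measurableI => //; exact: measurable_itv.
have -> : `]a, b]%classic `&` K = (K `&` `]0, b]%classic) `\` (K `&` `]0, a]%classic).
  apply/seteqP; split=> z.
    move=> [/=]; rewrite in_itv/= => /andP[az zb] Kz; split.
      by split => //=; rewrite in_itv/= zb (le_lt_trans a0 az).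
    by move=> [_] /=; rewrite in_itv/= => /andP[_]; rewrite leNgt az.
  move=> [[Kz] /=]; rewrite in_itv/= => /andP[z0 zb] H; split => //.
  rewrite /= in_itv/= zb andbT ltNge; apply/negP => za; apply: H.
  by split => //=; rewrite in_itv/= z0 za.
have SI := setIidr sub.
rewrite measureD ?SI//; last first.
  by have := LS_fin F b mK; rewrite ge0_fin_numE ?measure_ge0.
by rewrite EFinB !fineK ?LS_fin.
Qed.

(** The integral of 1_K along a path is again a path of the same kind, whose
    signed measure is the restriction to K. *)
Lemma charge_path_decomposition F G K : measurable K -> exists F' G',
  decomposes (fun t => charge F G t K) F' G' /\
  forall t L, measurable L -> charge F' G' t L = charge F G t (K `&` L).
Proof.
move=> mK; have [F' FE] := cut_cumulative F mK; have [G' GE] := cut_cumulative G mK.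
exists F', G'; split=> [s _|t L mL]; first by rewrite FE GE.
by rewrite /charge (LS_cut mK FE) // (LS_cut mK GE).
Qed.

End paths.

(** * Dyadic grids *)

Section grid.
Context {R : realType}.
Implicit Types (f g h : R -> R) (s t : R) (k n : nat).

(** For s >= 0, the index of the cell ](n - 1) / 2 ^ k, n / 2 ^ k] containing s;
    it is 0 exactly when s = 0. *)
Definition grid_index k s : nat := `|Num.ceil (s * 2 ^+ k)|%N.
Definition grid k n : R := n%:R / 2 ^+ k.
Definition grid_up k s := grid k (grid_index k s).
(** At s = 0 the truncated predecessor leaves the grid point at 0, in accordance
    with the convention that the left limit at 0 is the value at 0. *)
Definition grid_down k s := grid k (grid_index k s).-1.

(** A Galois connection between indices and times: all properties of the cells
    follow from it. *)
Lemma grid_indexP k s n : 0 <= s -> (grid_index k s <= n)%N = (s <= grid k n).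
Proof.
move=> s0; rewrite /grid_index /grid ler_pdivlMr ?exprn_gt0//.
have c0 : (0 <= Num.ceil (s * 2 ^+ k))%R.
  by rewrite -(ceil0 R) le_ceil// mulr_ge0.
by rewrite -lez_nat gez0_abs// ceil_le_int.
Qed.

Lemma gridS k n : grid k n.+1 = grid k n + 2 ^- k.
Proof. by rewrite /grid -natr1 mulrDl mul1r. Qed.

Lemma grid_ge0 k n : 0 <= grid k n.
Proof. by rewrite /grid divr_ge0. Qed.

Lemma grid0 k : grid k 0 = 0.
Proof. by rewrite /grid mul0r. Qed.

Lemma le_grid k m n : (m <= n)%N -> grid k m <= grid k n.
Proof. by move=> mn; rewrite /grid ler_wpM2r ?invr_ge0// ler_nat. Qed.

Lemma le_grid_up k s : 0 <= s -> s <= grid_up k s.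
Proof. by move=> s0; rewrite -grid_indexP. Qed.

Lemma grid_index_gt0 k s : 0 < s -> (0 < grid_index k s)%N.
Proof. by move=> s0; rewrite ltnNge grid_indexP ?(ltW s0)// grid0 -ltNge. Qed.

Lemma grid_down_lt k s : 0 < s -> grid_down k s < s.
Proof.
move=> s0; rewrite ltNge -grid_indexP ?(ltW s0)// -ltnNge.
by rewrite prednK// grid_index_gt0.
Qed.

Lemma grid_up_down k s : 0 < s -> grid_up k s = grid_down k s + 2 ^- k.
Proof. by move=> s0; rewrite /grid_up /grid_down -gridS prednK// grid_index_gt0. Qed.

Lemma grid_upB k s : 0 <= s -> grid_up k s <= s + 2 ^- k.
Proof.
rewrite le_eqVlt => /predU1P[<-|s0]; last first.
  by rewrite grid_up_down// lerD2r ltW// grid_down_lt.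
have -> : grid_up k 0 = 0.
  apply/eqP; rewrite eq_le /grid_up grid_ge0 andbT -[leRHS](grid0 k) le_grid//.
  by rewrite grid_indexP// grid_ge0.
by rewrite add0r invr_ge0 exprn_ge0.
Qed.

Lemma grid_down_ge k s : 0 < s -> s - 2 ^- k <= grid_down k s.
Proof. by move=> s0; rewrite lerBlDr -grid_up_down// le_grid_up// ltW. Qed.

Lemma le_grid_index k s t : 0 <= s -> s <= t -> (grid_index k s <= grid_index k t)%N.
Proof.
by move=> s0 st; rewrite grid_indexP// (le_trans st)// le_grid_up// (le_trans s0).
Qed.

Lemma grid_index_cell k n s : grid k n < s -> s <= grid k n.+1 -> grid_index k s = n.+1.
Proof.
move=> ns sn; have s0 : 0 < s := le_lt_trans (grid_ge0 _ _) ns.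
apply/eqP; rewrite eqn_leq grid_indexP ?(ltW s0)// sn /= ltnNge grid_indexP ?(ltW s0)//.
by rewrite -ltNge.
Qed.

Lemma cvg_invexp2 : (fun k => 2 ^- k : R) @ \oo --> (0 : R).
Proof.
have : (fun k => (2^-1 : R) ^+ k) @ \oo --> (0 : R).
  apply: cvg_expr; rewrite ger0_norm; lra.
by under eq_fun do rewrite exprVn.
Qed.

Lemma cvg_at_right_seq f s (u : nat -> R) : (forall k, s <= u k) ->
  (u k @[k --> \oo] --> s) -> (f x @[x --> s^'+] --> f s) -> (fun k => f (u k)) @ \oo --> f s.
Proof.
move=> su us /cvgrPdist_lt frc; apply/cvgrPdist_lt => e e0.
have [d /= d0 H] := frc e e0.
move/cvgrPdist_lt : us => /(_ d d0); apply: filterS => k usk.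
have := su k; rewrite le_eqVlt => /predU1P[<-|suk]; first by rewrite subrr normr0.
by apply: H.
Qed.

Lemma cvg_at_left_seq f s (l : R) (u : nat -> R) : (forall k, u k < s) ->
  (u k @[k --> \oo] --> s) -> (f x @[x --> s^'-] --> l) -> (fun k => f (u k)) @ \oo --> l.
Proof.
move=> su us /cvgrPdist_lt frc; apply/cvgrPdist_lt => e e0.
have [d /= d0 H] := frc e e0.
move/cvgrPdist_lt : us => /(_ d d0); apply: filterS => k usk.
by apply: H.
Qed.

Lemma cvg_grid_up s : 0 <= s -> (fun k => grid_up k s) @ \oo --> s.
Proof.
move=> s0; apply: (@squeeze_cvgr _ _ _ _ (cst s) (fun k => s + 2 ^- k)).
- by apply: nearW => k; rewrite le_grid_up// grid_upB.
- exact: cvg_cst.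
- by rewrite -[X in _ --> X]addr0; apply: cvgD; [exact: cvg_cst|exact: cvg_invexp2].
Qed.

Lemma cvg_grid_down s : 0 < s -> (fun k => grid_down k s) @ \oo --> s.
Proof.
move=> s0; apply: (@squeeze_cvgr _ _ _ _ (fun k => s - 2 ^- k) (cst s)).
- by apply: nearW => k; rewrite grid_down_ge// ltW// grid_down_lt.
- by rewrite -[X in _ --> X]subr0; apply: cvgB; [exact: cvg_cst|exact: cvg_invexp2].
- exact: cvg_cst.
Qed.

Lemma cadlag_grid_up f s : cadlag_path f -> 0 <= s ->
  (fun k => f (grid_up k s)) @ \oo --> f s.
Proof.
move=> [frc _] s0; apply: cvg_at_right_seq; [|exact: cvg_grid_up|exact: frc].
by move=> k; exact: le_grid_up.
Qed.

Lemma cadlag_grid_down f s : cadlag_path f -> 0 <= s ->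
  (fun k => f (grid_down k s)) @ \oo --> left_limit f s.
Proof.
move=> [_ fl]; rewrite le_eqVlt => /predU1P[<-|s0].
  rewrite /left_limit lexx; apply: cvg_near_cst; apply: nearW => k; congr f.
  rewrite /grid_down (_ : grid_index k 0 = 0)%N ?grid0//.
  by apply/eqP; rewrite -leqn0 grid_indexP// grid0.
rewrite /left_limit leNgt s0/=; apply: (cvg_at_left_seq (s := s)); last exact: fl.
- by move=> k; exact: grid_down_lt.
- exact: cvg_grid_down.
Qed.

End grid.

(** * Additivity of the signed measure *)

Section charge_additivity.
Context {R : realType}.
Implicit Types (f g h : R -> R) (F G H : cumulative R R) (K L : set (measurableTypeR R)).

Lemma charge_setT f F G t : decomposes f F G -> 0 <= t ->
  charge F G t setT = f t - f 0.
Proof.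
move=> fFG t0; by rewrite -charge_itvI setTI (charge_itv fFG)// minxx min_l.
Qed.

Lemma charge_setC F G t K : measurable K ->
  charge F G t (~` K) = charge F G t setT - charge F G t K.
Proof.
move=> mK.
have E H : fine (LS H (setT `&` `]0%R, t]%classic)) =
    fine (LS H (K `&` `]0%R, t]%classic)) + fine (LS H (~` K `&` `]0%R, t]%classic)).
  rewrite -fineD ?LS_fin//; last exact: measurableC.
  rewrite -measureU//.
  - by rewrite -setIUl setUCr.
  - by apply: measurableI => //; exact: measurable_itv.
  - by apply: measurableI; [exact: measurableC|exact: measurable_itv].
  - by rewrite setIACA setICr set0I.
by rewrite /charge !E; lra.
Qed.

Lemma charge_bigcup F G t (K : (set (measurableTypeR R))^nat) :
  (forall n, measurable (K n)) -> trivIset setT K ->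
  \sum_(0 <= i < n) charge F G t (K i) @[n --> \oo] --> charge F G t (\bigcup_n K n).
Proof.
move=> mK tK.
have E H : \sum_(0 <= i < n) fine (LS H (K i `&` `]0%R, t]%classic)) @[n --> \oo] -->
    fine (LS H ((\bigcup_n K n) `&` `]0%R, t]%classic)).
  have mKi n : measurable (K n `&` `]0%R, t]%classic).
    by apply: measurableI => //; exact: measurable_itv.
  have := @measure_semi_sigma_additive _ _ _ (LS H) (fun n => K n `&` `]0%R, t]%classic) mKi.
  move=> /(_ (trivIset_setIr tK)); rewrite -setI_bigcupl.
  have mU : measurable (\bigcup_n K n) by exact: bigcupT_measurable.
  move=> /(_ (measurableI _ _ mU (measurable_itv _))).
  rewrite -[X in _ --> X]fineK ?LS_fin// => /fine_cvg.
  apply: cvg_trans; apply: near_eq_cvg; apply: nearW => n /=.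
  by rewrite sum_fine// => i _; exact: LS_fin.
rewrite /charge; under eq_fun do rewrite sumrB.
exact: cvgB.
Qed.

End charge_additivity.

(** * The predictable sigma-algebra *)

Section predictable.
Context {d : measure_display} {T : measurableType d} {R : realType}.
Variable F : R -> set (set T).
Hypothesis hF : filtration F.

Definition timespace : set (R * T) := `[0, +oo[ `*` setT.

Definition predictable_generators : set (set (R * T)) :=
  [set [set 0] `*` B | B in F 0] `|`
      [set H | exists s t B,
        [/\ 0 <= s, s < t, F s B & H = `]s, t] `*` B]].

(** The sigma-algebra is generated on the whole of R * T rather than on the
    half-space [0, +oo[ * T, so as to obtain a measurable space on a type;
    [predictable_trace] and [predictable_measurable] compare the two. *)
Definition predictableType := g_sigma_algebraType predictable_generators.

Let G := predictable_generators.

Lemma filtration_setT s : 0 <= s -> F s setT.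
Proof.
by move=> s0; have [/(_ s s0)[F0 FD _] _ _] := hF; rewrite -(setD0 setT); exact: FD.
Qed.

Lemma filtration_setC s B : 0 <= s -> F s B -> F s (~` B).
Proof. by move=> s0 FB; have [/(_ s s0)[_ FD _] _ _] := hF; rewrite -setTD; exact: FD. Qed.

Lemma filtration_bigcup s (B : (set T)^nat) : 0 <= s -> (forall n, F s (B n)) -> F s (\bigcup_n B n).
Proof. by move=> s0 FB; have [/(_ s s0)[_ _ FB'] _ _] := hF; exact: FB'. Qed.

Lemma filtration_le s t B : 0 <= s -> s <= t -> F s B -> F t B.
Proof. by move=> s0 st; have [_ _ /(_ s t s0 st)] := hF; exact. Qed.

Lemma filtration_measurable s B : 0 <= s -> F s B -> measurable B.
Proof. by move=> s0; have [_ /(_ s s0) + _] := hF; exact. Qed.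

Lemma filtration_setI s A B : 0 <= s -> F s A -> F s B -> F s (A `&` B).
Proof.
move=> s0 FA FB.
have -> : A `&` B = ~` (\bigcup_n (if n is 0 then ~` A else ~` B)).
  rewrite setC_bigcup; apply/seteqP; split=> w.
    by move=> [Aw Bw] [|n] _; rewrite setCK.
  by move=> H; move: (H 0%N I) (H 1%N I); rewrite !setCK.
by apply: filtration_setC => //; apply: filtration_bigcup => // -[|n]; exact: filtration_setC.
Qed.

Lemma predictable_generators_sub g : G g -> g `<=` timespace.
Proof.
case=> [[B _ <-]|[s [t [B [s0 st _ ->]]]]] [u w] [/=].
  by move=> -> _; split => //=; rewrite in_itv/= lexx.
by rewrite in_itv/= => /andP[/ltW su _] _; split => //=; rewrite in_itv/= (le_trans s0).
Qed.

Lemma measurable_after s B : 0 <= s -> F s B ->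
  measurable (`]s, +oo[ `*` B : set predictableType).
Proof.
move=> s0 FB; rewrite [X in measurable X](_ : _ = \bigcup_n (`]s, s + n.+1%:R] `*` B)).
  apply: bigcupT_measurable => n; apply: sub_sigma_algebra; right.
  by exists s, (s + n.+1%:R), B; split => //; rewrite ltrDl.
apply/seteqP; split=> [[u w] [/=]|[u w] [n _ [/=]]].
  rewrite in_itv/= andbT => su Bw; exists (Num.truncn (u - s)) => //; split => //=.
  by rewrite in_itv/= su -lerBlDl ltW// truncnS_gt.
by rewrite !in_itv/= => /andP[-> _].
Qed.

Lemma measurable_atzero B : F 0 B -> measurable ([set 0] `*` B : set predictableType).
Proof. by move=> FB; apply: sub_sigma_algebra; left; exists B. Qed.

Lemma measurable_timespace : measurable (timespace : set predictableType).
Proof.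
have -> : timespace = ([set 0] `*` setT) `|` (`]0, +oo[ `*` setT).
  apply/seteqP; split=> [[u w] [/=]|[u w] [[/= -> _]|[/=]]].
  - rewrite in_itv/= andbT le_eqVlt => /predU1P[<- _|u0 _]; first by left.
    by right; split => //=; rewrite in_itv/= u0.
  - by split => //=; rewrite in_itv/= lexx.
  - by rewrite in_itv/= andbT => u0 _; split => //=; rewrite in_itv/= ltW.
apply: measurableU; first by apply: measurable_atzero; exact: filtration_setT.
by apply: measurable_after => //; exact: filtration_setT.
Qed.

Lemma predictable_trace Q :
  measurable (Q : set predictableType) -> predictable_sigma_algebra F (timespace `&` Q).
Proof.
have sD := smallest_sigma_algebra timespace G.
suff: <<s G >> `<=` [set Q | predictable_sigma_algebra F (timespace `&` Q)] by apply.
apply: smallest_sub => [|g Gg]; last first.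
  by rewrite /= setIidr; [exact: sub_sigma_algebra|exact: predictable_generators_sub].
have [s0 sC sU] := sD; split => /=.
- by rewrite setI0.
- move=> A sA; have := sC _ sA.
  by congr (predictable_sigma_algebra F _); rewrite setTD setDIr setDv set0U setDE.
- by move=> A sA; rewrite setI_bigcupr; exact: sU.
Qed.

Lemma predictable_measurable Q :
  predictable_sigma_algebra F Q -> measurable (Q : set predictableType).
Proof.
suff: predictable_sigma_algebra F `<=`
  [set Q | measurable (Q : set predictableType)] by apply.
apply: smallest_sub => [|g Gg]; last exact: sub_sigma_algebra.
split.
- exact: measurable0.
- by move=> A mA; apply: measurableD => //; exact: measurable_timespace.
- by move=> A mA; exact: bigcupT_measurable.
Qed.

Lemma predictableP (X : R -> T -> R) : predictable F X <->
  measurable_fun (timespace : set predictableType) (fun p => X p.1 p.2).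
Proof.
split=> [pX _ B mB|mX B mB].
  exact: predictable_measurable (pX B mB).
have := predictable_trace (mX measurable_timespace B mB).
by rewrite setIA setIid.
Qed.

(** The sets in the filtration are measurable, so predictable sets are
    measurable for the product; sections and values at random times then become
    measurable. *)
Lemma predictable_prod Q : measurable (Q : set predictableType) -> measurable (Q : set (R * T)).
Proof.
suff: <<s G >> `<=` [set Q | measurable (Q : set (R * T))] by apply.
apply: smallest_sub => [|g].
  by split; [exact: measurable0|move=> A mA; rewrite setTD; exact: measurableC|
    move=> A mA; exact: bigcupT_measurable].
case=> [[B FB <-]|[s [t [B [s0 st FB ->]]]]]; apply: measurableX => //=.
- exact: filtration_measurable FB.
- exact: filtration_measurable FB.
Qed.

Lemma measurable_at_random_time (X : R -> T -> R) (rho : T -> R) :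
  predictable F X -> measurable_fun setT rho -> (forall w, 0 <= rho w) ->
  measurable_fun setT (fun w => X (rho w) w).
Proof.
move=> pX mrho rho0 _ B mB; rewrite setTI.
have mQ := predictable_prod (predictable_measurable (pX B mB)).
have -> : (fun w => X (rho w) w) @^-1` B =
    (fun w => (rho w, w)) @^-1` ((`[0, +oo[ `*` setT) `&` (fun p => X p.1 p.2) @^-1` B).
  apply/seteqP; split=> w /= => [XB|[]//].
  by split => //; split => //; rewrite in_itv/= rho0.
rewrite -[X in measurable X]setTI.
by apply: (measurable_fun_pair mrho (@measurable_id _ _ _)).
Qed.

Lemma measurable_section (Q : set (R * T)) w :
  measurable (Q : set predictableType) -> measurable ([set s | Q (s, w)] : set (measurableTypeR R)).
Proof.
move=> /predictable_prod mQ; have := measurable_ysection w mQ.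
by congr (measurable _); apply/seteqP; split=> s; rewrite /ysection/= inE.
Qed.

(** The process frozen at the left end of each cell is constant on the
    rectangles ]n / 2 ^ k, (n + 1) / 2 ^ k] * B with B known at time n / 2 ^ k.
    *)
Lemma predictable_grid_down (X : R -> T -> R) k : adapted F X ->
  predictable F (fun s w => X (grid_down k s) w).
Proof.
move=> aX; apply/predictableP => _ B mB.
have -> : timespace `&` (fun p => X (grid_down k p.1) p.2) @^-1` B =
  ([set 0] `*` (X 0 @^-1` B)) `|`
  \bigcup_n (`](grid k n), (grid k n.+1)] `*` (X (grid k n) @^-1` B)).
  have gd0 : grid_down k 0 = 0 :> R.
    rewrite /grid_down (_ : grid_index k 0 = 0)%N ?grid0//.
    by apply/eqP; rewrite -leqn0 grid_indexP// grid0.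
  apply/seteqP; split=> [[s w]|[s w]].
    move=> [[/=]]; rewrite in_itv/= andbT le_eqVlt => /predU1P[<- _ XB|s0 _ XB].
      by left; split => //=; move: XB; rewrite gd0.
    right; exists (grid_index k s).-1 => //; split => //=.
    rewrite in_itv/= prednK ?grid_index_gt0// le_grid_up ?(ltW s0)// andbT.
    exact: grid_down_lt.
  move=> [[/= -> XB]|[n _ [/=]]].
    by split; [split => //=; rewrite in_itv/= lexx|rewrite /= gd0].
  rewrite in_itv/= => /andP[ns sn] XB.
  have s0 : 0 < s := le_lt_trans (grid_ge0 _ _) ns.
  split; first by split => //=; rewrite in_itv/= ltW.
  by rewrite /= /grid_down (grid_index_cell ns sn).
apply: measurableU; first by apply: measurable_atzero; exact: aX.
apply: bigcupT_measurable => n; apply: sub_sigma_algebra; right.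
exists (grid k n), (grid k n.+1), (X (grid k n) @^-1` B); split => //.
- exact: grid_ge0.
- by rewrite gridS ltrDl invr_gt0 exprn_gt0.
- by apply: aX => //; exact: grid_ge0.
Qed.

Lemma predictable_left_limit (X : R -> T -> R) : adapted F X -> cadlag X ->
  predictable F (fun s w => left_limit (X ^~ w) s).
Proof.
move=> aX cX; apply/predictableP.
apply: (@measurable_fun_cvg _ predictableType R timespace
  (fun k p => X (grid_down k p.1) p.2)).
  by move=> k; exact: (predictableP _).1 (predictable_grid_down k aX).
move=> [s w] [/= + _]; rewrite in_itv/= andbT => s0.
exact: (cadlag_grid_down (cX w) s0).
Qed.

End predictable.

(** * Predictability of integrals of predictable sets *)

Section charge_predictable.
Context {d : measure_display} {T : measurableType d} {R : realType}.
Variable F : R -> set (set T).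
Hypothesis hF : filtration F.
Local Notation PT := (predictableType F).
Local Notation D := (@timespace d T R).

Lemma predictable_generators_setI : setI_closed (predictable_generators F).
Proof.
have gen0 : predictable_generators F set0.
  have [/(_ 0 (lexx 0))[F0 _ _] _ _] := hF.
  by left; exists set0; rewrite ?setX0.
move=> _ _ [[B FB <-]|[s [t [B [s0 st FB ->]]]]] [[B' FB' <-]|[s' [t' [B' [s0' st' FB' ->]]]]].
- rewrite -setXI setIid; left; exists (B `&` B') => //; exact: filtration_setI.
- rewrite -setXI (_ : _ `&` _ = set0) ?set0X//.
  apply/seteqP; split=> // x [/= x0]; rewrite x0 /= in_itv/= => /andP[+ _].
  by rewrite ltNge s0'.
- rewrite -setXI (_ : _ `&` _ = set0) ?set0X//.
  apply/seteqP; split=> // x [/= + x0]; rewrite x0 /= in_itv/= => /andP[+ _].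
  by rewrite ltNge s0.
- rewrite -setXI (_ : _ `&` _ = `](Num.max s s'), (Num.min t t')]%classic); last first.
    apply/seteqP; split=> x /=; rewrite !in_itv/= gt_max le_min.
      by move=> [/andP[-> ->] /andP[-> ->]].
    by move=> /andP[/andP[-> ->] /andP[-> ->]].
  have [m|m] := ltP (Num.max s s') (Num.min t t'); last first.
    by rewrite set_itv_ge ?set0X// bnd_simp -leNgt.
  right; exists (Num.max s s'), (Num.min t t'), (B `&` B'); split => //.
    by rewrite le_max s0.
  by apply: (filtration_setI hF); [rewrite le_max s0|apply: (filtration_le hF s0) FB; rewrite le_max lexx|
    apply: (filtration_le hF s0') FB'; rewrite le_max lexx orbT].
Qed.

Variables (A : R -> T -> R).
Hypotheses (aA : adapted F A) (pA : predictable F A).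

(** This is the integral of the indicator of ]s, +oo[ * B; differences of two of
    them give the generating rectangles ]s, u] * B. *)
Lemma measurable_increment_after s B : 0 <= s -> F s B ->
  measurable_fun (D : set PT)
    ((fun p => A p.1 p.2 - A s p.2) \_ (`]s, +oo[ `*` B)).
Proof.
move=> s0 FB.
have mS : measurable (`]s, +oo[ `*` B : set PT) by exact: measurable_after.
have SD : `]s, +oo[ `*` B `<=` D.
  move=> [u w] [/=]; rewrite in_itv/= andbT => su _; split => //=.
  by rewrite in_itv/= andbT (le_trans s0)// ltW.
apply: (measurable_restrict _ mS (measurable_timespace hF)).1.
rewrite setIidr//; apply: measurable_funB.
  apply: (measurable_funS (measurable_timespace hF) SD).
  exact: (predictableP hF _).1 pA.
move=> _ C mC.
rewrite [X in measurable X](_ : _ = `]s, +oo[ `*` (B `&` (A s @^-1` C))).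
  by apply: measurable_after => //; apply: filtration_setI => //; exact: aA.
by apply/seteqP; split=> [[u w] [[/= su Bw] Cw]|[u w] [/= su [Bw Cw]]].
Qed.

Variables (Fw Gw : T -> cumulative R R).
Hypothesis AFG : forall w, decomposes (A ^~ w) (Fw w) (Gw w).

Definition charge_process (Q : set (R * T)) (t : R) (w : T) : R :=
  charge (Fw w) (Gw w) t [set s | Q (s, w)].

(** The sets with this property form a Dynkin class containing the generators,
    where the integral is an explicit increment of A. *)
Lemma predictable_charge Q : measurable (Q : set PT) ->
  predictable F (charge_process Q).
Proof.
move=> mQ; apply/(predictableP hF).
suff H : forall Q, <<s predictable_generators F >> Q ->
  measurable_fun (D : set PT) (fun p => charge_process Q p.1 p.2) by exact: H mQ.
have HT : measurable_fun (D : set PT) (fun p => charge_process setT p.1 p.2).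
  apply: eq_measurable_fun (measurable_increment_after (lexx 0) (filtration_setT hF (lexx 0))).
  move=> [t w]; rewrite inE => -[/= + _]; rewrite in_itv/= andbT => t0.
  rewrite /charge_process [X in charge _ _ _ X](_ : _ = setT); last by apply/seteqP.
  rewrite (charge_setT (AFG w) t0) patchE.
  case: ifPn => //; rewrite notin_setE/= => H.
  move: t0; rewrite le_eqVlt => /predU1P[<-|t0]; first by rewrite subrr.
  by exfalso; apply: H; split => //=; rewrite in_itv/= t0.
apply: (@dynkin_induction _ PT (predictable_generators F)) => //.
- exact: predictable_generators_setI.
- move=> _ [[B FB <-]|[s [u [B [s0 su FB ->]]]]].
    apply: eq_measurable_fun (measurable_cst (0 : R)) => -[t w] _ /=.
    rewrite /charge_process -charge_itvI (_ : _ `&` _ = set0) /charge ?set0I ?measure0 ?subrr//.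
    apply/seteqP; split=> // x [/= [-> _]]; rewrite in_itv/=.
    by rewrite ltxx.
  have su' := ltW su; have u0 := le_trans s0 su'.
  have m1 := measurable_increment_after s0 FB.
  have m2 := measurable_increment_after u0 (filtration_le hF s0 su' FB).
  apply: eq_measurable_fun (measurable_funB m1 m2) => -[t w].
  rewrite inE => -[/= + _]; rewrite in_itv/= andbT => t0.
  rewrite /charge_process !patchE.
  have [Bw|Bw] := pselect (B w); last first.
    rewrite !memNset; [|by move=> []..].
    rewrite (_ : [set _ | _] = set0) /charge ?set0I ?measure0 ?subrr//.
    by apply/seteqP; split=> // x [].
  rewrite [X in charge _ _ _ X](_ : _ = `]s, u]%classic); last first.
    by apply/seteqP; split=> // x [].
  have inS v : ((t, w) \in `]v, +oo[%classic `*` B) = (v < t).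
    by apply/idP/idP; rewrite inE/= in_itv/= andbT; [case|].
  rewrite (charge_itv (AFG w))// !inS.
  have [ts|st] := leP t s.
    by rewrite (le_gtF (le_trans ts su')) !min_r ?subrr// (le_trans ts).
  (* The default value of the restricted functions outside their domain is
     [point]. *)
  have pt0 : point = 0 :> R by [].
  have [tu|ut] := leP t u; first by rewrite /= pt0 subr0.
  by rewrite /=; lra.
- move=> S mS PS; apply: eq_measurable_fun (measurable_funB HT PS) => -[t w] _ /=.
  have mSw := measurable_section hF w mS.
  rewrite /charge_process; rewrite (_ : [set s | (~` S) (s, w)] = ~` [set s | S (s, w)])//.
  by rewrite charge_setC.
- move=> S mS tS PS.
  apply: (@measurable_fun_cvg _ PT R D
    (fun n p => \sum_(0 <= i < n) charge_process (S i) p.1 p.2)).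
    by move=> n; exact: measurable_sum.
  move=> [t w] _ /=; rewrite /charge_process.
  rewrite (_ : [set s | (\bigcup_k S k) (s, w)] = \bigcup_k [set s | S k (s, w)])//.
  apply: charge_bigcup => [n|]; first exact: (measurable_section hF).
  apply/trivIsetP => i j _ _ ij; apply/seteqP; split=> // s [Si Sj].
  by move/trivIsetP : tS => /(_ i j I I ij) /seteqP[+ _] => /(_ (s, w) (conj Si Sj)).
Qed.

End charge_predictable.

(** * Dominated convergence and uniform integrability *)

Section real_dominated_convergence.
Context d (T : measurableType d) (R : realType) (mu : {measure set T -> \bar R}).

Lemma Rintegral_dominated_cvg (D : set T) (f_ : nat -> T -> R) (f g : T -> R) :
  measurable D -> (forall n, measurable_fun D (f_ n)) ->
  (forall x, D x -> f_ n x @[n --> \oo] --> f x) ->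
  mu.-integrable D (EFin \o g) -> (forall n x, D x -> `|f_ n x| <= g x) ->
  mu.-integrable D (EFin \o f) /\
  \int[mu]_(x in D) f_ n x @[n --> \oo] --> \int[mu]_(x in D) f x.
Proof.
move=> mD mf_ f_f ig f_g.
have mf : measurable_fun D f by exact: measurable_fun_cvg mf_ f_f.
have [] := @dominated_convergence _ _ _ mu D mD (fun n => EFin \o f_ n) (EFin \o f) (EFin \o g).
- by move=> n; exact/measurable_EFinP.
- exact/measurable_EFinP.
- by apply: aeW => x Dx /=; apply: cvg_EFin; [exact: nearW|exact: f_f].
- by [].
- by apply: aeW => x n Dx /=; rewrite lee_fin f_g.
move=> fi _ cv; split=> //.
apply: fine_cvg; rewrite fineK; last exact: integrable_fin_num.
exact: cv.
Qed.

End real_dominated_convergence.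

Section uniform_integrability.
Context d (T : measurableType d) (R : realType) (P : probability T R).
Implicit Types (Z : T -> R) (K x : R).

Local Notation integ Z := (P.-integrable setT (EFin \o Z)).

(** Uniform integrability is expressed by tails E [(|Z| - K)^+], which, unlike E
    [|Z| 1_{|Z| > K}], are expectations of a convex function of Z and hence grow
    along martingales. *)
Definition excess K x : R := Num.max (`|x| - K) 0.
Definition clamp K x : R := Num.max (- K) (Num.min x K).

Lemma clampB K x : 0 <= K -> `|x - clamp K x| = excess K x.
Proof.
move=> K0; rewrite /clamp /excess.
have [xK|Kx] := leP x K; last first.
  have -> : Num.max (- K) K = K by rewrite max_r//; lra.
  rewrite (gtr0_norm (le_lt_trans K0 Kx)) max_l; last by lra.
  by rewrite gtr0_norm//; lra.
have [Kx|xK'] := leP (- K) x.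
  by rewrite subrr normr0 max_r// subr_le0 ler_norml Kx xK.
have -> : `|x| = - x by rewrite ltr0_norm//; lra.
rewrite max_l; last by lra.
by rewrite ltr0_norm; lra.
Qed.

Lemma clamp_le K x : 0 <= K -> `|clamp K x| <= K.
Proof.
move=> K0; rewrite /clamp ler_norml le_max lexx /= ge_max ge_min lexx orbT andbT.
lra.
Qed.

Lemma clamp_le_norm K x : 0 <= K -> `|clamp K x| <= `|x|.
Proof.
move=> K0; rewrite /clamp; have [xK|Kx] := leP x K; last first.
  by rewrite max_r ?ger0_norm; lra.
have [//|xK'] := leP (- K) x.
rewrite normrN ger0_norm// -normrN; apply: le_trans (ler_norm _); lra.
Qed.

Lemma continuous_clamp K : continuous (clamp K).
Proof.
move=> x; apply: (@continuous_max R R (fun=> - K) (fun y => Num.min y K)).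
  exact: cst_continuous.
by apply: (@continuous_min R R id (fun=> K)); [exact: cvg_id|exact: cst_continuous].
Qed.

Lemma measurable_clamp K Z D : measurable_fun D Z -> measurable_fun D (fun w => clamp K (Z w)).
Proof.
by move=> mZ; apply: measurable_maxr => //; apply: measurable_minr.
Qed.

Lemma measurable_excess K Z D : measurable_fun D Z -> measurable_fun D (fun w => excess K (Z w)).
Proof.
move=> mZ; apply: measurable_maxr => //; apply: measurable_funB => //.
exact: measurableT_comp.
Qed.

Lemma excess_ge0 K x : 0 <= excess K x.
Proof. by rewrite /excess le_max lexx orbT. Qed.

Lemma excess_le K x : 0 <= K -> excess K x <= `|x|.
Proof. by move=> K0; rewrite /excess ge_max normr_ge0 gerBl K0. Qed.

Lemma integrable_excess K Z : 0 <= K -> integ Z -> integ (fun w => excess K (Z w)).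
Proof.
move=> K0 iZ; have /integrableP[/measurable_EFinP mZ _] := iZ.
apply: le_integrable iZ => //; first exact/measurable_EFinP/measurable_excess.
by move=> w _ /=; rewrite lee_fin ger0_norm ?excess_ge0// excess_le.
Qed.

Lemma integrable_on Z B : measurable B -> integ Z -> P.-integrable B (EFin \o Z).
Proof. by move=> mB; apply: integrableS. Qed.

Lemma integrable_measurable Z : integ Z -> measurable_fun setT Z.
Proof. by case/integrableP => /measurable_EFinP. Qed.

Lemma integrable_cst_fun (c : R) B : measurable B -> P.-integrable B (EFin \o (fun=> c)).
Proof.
move=> mB; apply: measurable_bounded_integrable => //.
  by rewrite (le_lt_trans (probability_le1 P mB))// ltry.
by apply: (bounded_on_le (c := `|c|)).
Qed.

Lemma le_Rintegral_subset Z A B : measurable A -> measurable B -> A `<=` B -> integ Z ->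
  (forall w, 0 <= Z w) -> \int[P]_(w in A) Z w <= \int[P]_(w in B) Z w.
Proof.
move=> mA mB AB iZ Z0; rewrite /Rintegral fine_le//.
- by apply: integrable_fin_num => //; exact: integrable_on.
- by apply: integrable_fin_num => //; exact: integrable_on.
- apply: ge0_subset_integral => //.
    exact/measurable_funTS/measurable_EFinP/integrable_measurable.
  by move=> w _; rewrite lee_fin.
Qed.

(** Truncation at level K costs at most the excess over K in expectation,
    uniformly along the sequence; truncated variables converge by domination,
    and K then tends to infinity. *)
Lemma uniformly_integrable_limit (Z : nat -> T -> R) (Z0 y : T -> R) B (c : R) :
  measurable B -> (forall k, integ (Z k)) -> integ y ->
  (forall w, Z k w @[k --> \oo] --> Z0 w) ->
  (forall k K, 0 <= K ->
    \int[P]_w excess K (Z k w) <= \int[P]_w excess K (y w)) ->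
  (forall k, \int[P]_(w in B) Z k w = c) ->
  integ Z0 /\ \int[P]_(w in B) Z0 w = c.
Proof.
move=> mB iZ iy ZZ0 tail ZBc.
have mZ k := integrable_measurable (iZ k).
have mZ0 : measurable_fun setT Z0.
  by apply: (measurable_fun_cvg mZ) => w _; exact: ZZ0.
have EFinR (h : T -> R) : integ h -> (forall w, 0 <= h w) ->
    (\int[P]_w (h w)%:E)%E = (\int[P]_w h w)%:E.
  by move=> ih h0; rewrite /Rintegral fineK//; exact: integrable_fin_num.
(* Fatou, with the bound given by the excess over K = 0, which is the norm. *)
have iZ0 : integ Z0.
  apply/integrableP; split; first exact/measurable_EFinP.
  have -> : (\int[P]_w `|(EFin \o Z0) w|)%E = (\int[P]_w limn_einf (fun k => `|Z k w|%:E))%E.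
    apply: eq_integral => w _ /=.
    have cv : (fun k => `|Z k w|%:E) @ \oo --> `|Z0 w|%:E.
      by apply: cvg_EFin; [exact: nearW|apply: cvg_norm; exact: ZZ0].
    by rewrite is_cvg_limn_einfE; [rewrite (cvg_lim _ cv)|apply/cvg_ex; eexists; exact: cv].
  apply: le_lt_trans (fatou P measurableT _ _) _ => //.
    by move=> k; apply/measurable_EFinP; exact: measurableT_comp.
  apply: (@le_lt_trans _ _ (\int[P]_w excess 0 (y w))%:E); last exact: ltry.
  rewrite limn_einf_lim; apply: lime_le; first exact: is_cvg_einfs.
  apply: nearW => n; apply: (@le_trans _ _ (\int[P]_w `|Z n w|%:E)%E).
    by apply: ereal_inf_lbound; exists n => //=.
  have e0 x : excess 0 x = `|x| by rewrite /excess subr0 max_l.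
  rewrite EFinR//; last exact: integrable_norm.
  by have := tail n 0 (lexx _); under eq_Rintegral do rewrite e0.
split=> //.
have mBZ k : measurable_fun B (Z k) by exact: measurable_funTS.
have mBZ0 : measurable_fun B Z0 by exact: measurable_funTS.
have iclamp K h : 0 <= K -> measurable_fun setT h -> P.-integrable B (EFin \o (fun w => clamp K (h w))).
  move=> K0 mh; apply: le_integrable (integrable_cst_fun K mB) => //.
    by apply/measurable_EFinP; apply: measurable_clamp; exact: measurable_funTS.
  by move=> w _ /=; rewrite lee_fin (ger0_norm K0) clamp_le.
have step1 k K : 0 <= K ->
    `|c - \int[P]_(w in B) clamp K (Z k w)| <= \int[P]_w excess K (y w).
  move=> K0; rewrite -(ZBc k) -RintegralB//; [|exact: integrable_on|exact: iclamp].
  apply: le_trans (tail k K K0).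
  have iB : P.-integrable B (EFin \o (fun w => Z k w - clamp K (Z k w))).
    rewrite (_ : _ \o _ = (fun w => ((Z k w)%:E - (clamp K (Z k w))%:E)%E))//.
    by apply: integrableB => //; [exact: integrable_on|exact: iclamp].
  apply: le_trans (le_normr_Rintegral mB iB) _.
  rewrite (@eq_Rintegral _ _ _ _ B (fun w => excess K (Z k w))) => [|w _]; last exact: clampB.
  apply: le_Rintegral_subset => //; first exact: integrable_excess.
  by move=> w; exact: excess_ge0.
have step2 K : 0 <= K -> `|c - \int[P]_(w in B) clamp K (Z0 w)| <= \int[P]_w excess K (y w).
  move=> K0.
  have [_ cv] : P.-integrable B (EFin \o (fun w => clamp K (Z0 w))) /\
     \int[P]_(w in B) clamp K (Z k w) @[k --> \oo] --> \int[P]_(w in B) clamp K (Z0 w).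
    apply: (Rintegral_dominated_cvg (g := fun=> K)) => //.
    + by move=> k; exact: measurable_clamp.
    + by move=> w _; apply: continuous_cvg; [exact: continuous_clamp|exact: ZZ0].
    + exact: integrable_cst_fun.
    + by move=> k w _; exact: clamp_le.
  have cv' : `|c - \int[P]_(w in B) clamp K (Z k w)| @[k --> \oo] --> `|c - \int[P]_(w in B) clamp K (Z0 w)|.
    by apply: cvg_norm; apply: cvgB => //; exact: cvg_cst.
  rewrite -(cvg_lim _ cv')//; apply: limr_le; first by apply/cvg_ex; eexists; exact: cv'.
  by apply: nearW => k; exact: step1.
have [_ cv0] : P.-integrable setT (EFin \o (fun=> 0 : R)) /\
    \int[P]_w excess n%:R (y w) @[n --> \oo] --> \int[P]_w (0 : R).
  apply: (Rintegral_dominated_cvg (g := fun w => `|y w|)) => //.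
  - by move=> n; apply: measurable_excess; exact: integrable_measurable.
  - move=> w _; apply: cvg_near_cst; near=> n; rewrite /excess max_r// subr_le0.
    by near: n; exact: nbhs_infty_ger.
  - exact: integrable_norm.
  - by move=> n w _; rewrite ger0_norm ?excess_ge0// excess_le.
have [_ cv1] : P.-integrable B (EFin \o Z0) /\
    \int[P]_(w in B) clamp n%:R (Z0 w) @[n --> \oo] --> \int[P]_(w in B) Z0 w.
  apply: (Rintegral_dominated_cvg (g := fun w => `|Z0 w|)) => //.
  - by move=> n; exact: measurable_clamp.
  - move=> w _; apply: cvg_near_cst; near=> n.
    apply/eqP; rewrite eq_sym -subr_eq0 -normr_eq0 clampB// /excess max_r// subr_le0.
    by near: n; exact: nbhs_infty_ger.
  - by apply: integrable_norm; exact: integrable_on.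
  - by move=> n w _; exact: clamp_le_norm.
have : `|c - \int[P]_(w in B) clamp n%:R (Z0 w)| @[n --> \oo] --> (0 : R).
  apply: (@squeeze_cvgr _ _ _ _ (cst 0) (fun n => \int[P]_w excess n%:R (y w))).
  - by apply: nearW => n; rewrite normr_ge0 step2.
  - exact: cvg_cst.
  - by move: cv0; rewrite Rintegral_cst// mul0r.
have cv2 : `|c - \int[P]_(w in B) clamp n%:R (Z0 w)| @[n --> \oo] --> `|c - \int[P]_(w in B) Z0 w|.
  by apply: cvg_norm; apply: cvgB => //; exact: cvg_cst.
move=> /(cvg_unique (@Rhausdorff R) cv2) /eqP.
by rewrite normr_eq0 subr_eq0 => /eqP.
Unshelve. all: by end_near. Qed.

End uniform_integrability.

(** * Optional stopping *)

Section optional_stopping.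
Context {d : measure_display} {T : measurableType d} {R : realType}.
Variables (P : probability T R) (F : R -> set (set T)).
Hypothesis hF : filtration F.
Local Notation integ Z := (P.-integrable setT (EFin \o Z)).

Lemma excess_split (K x : R) : 0 <= K ->
  excess K x = Num.max (x - K) 0 + Num.max (- x - K) 0.
Proof.
move=> K0; rewrite /excess; have [x0|x0] := leP 0 x.
  rewrite (ger0_norm x0).
  by rewrite (@max_r _ _ (- x - K)) ?addr0//; lra.
rewrite (ltr0_norm x0).
by rewrite (@max_r _ _ (x - K)) ?add0r//; lra.
Qed.

Lemma integrable_pospart (K : R) (y : T -> R) : 0 <= K -> integ y ->
  integ (fun w => Num.max (y w - K) 0).
Proof.
move=> K0 iy; have my := integrable_measurable iy.
apply: le_integrable iy => //.
  apply/measurable_EFinP; apply: measurable_maxr => //.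
  exact: measurable_funB.
move=> w _ /=; rewrite lee_fin ger0_norm; last by rewrite le_max lexx orbT.
by rewrite ge_max normr_ge0 andbT (le_trans _ (ler_norm _))// gerBl.
Qed.

(** Jensen's inequality for x |-> (x - K)^+ on the event G, as a consequence of
    E [y - K ; C] = E [z - K ; C] <= E [(z - K)^+ ; C] with C the part of G
    where y > K. *)
Lemma pospart_mono (y z : T -> R) (K : R) (H : set (set T)) G :
  0 <= K -> integ y -> integ z -> H `<=` measurable ->
  (forall C, H C -> \int[P]_(w in C) y w = \int[P]_(w in C) z w) ->
  H (G `&` [set w | K < y w]) -> measurable G ->
  \int[P]_(w in G) Num.max (y w - K) 0 <= \int[P]_(w in G) Num.max (z w - K) 0.
Proof.
move=> K0 iy iz Hm yz HG mG.
set C := G `&` _ in HG; have mC := Hm _ HG.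
have -> : \int[P]_(w in G) Num.max (y w - K) 0 = \int[P]_(w in C) (y w - K).
  rewrite /C Rintegral_mkcondr; apply: eq_Rintegral => w _.
  rewrite patchE; case: ifPn; rewrite ?inE ?notin_setE/=.
    by move=> Kw; rewrite max_l// subr_ge0 ltW.
  by move=> /negP; rewrite -leNgt => yK; rewrite max_r// subr_le0.
have iC (h : T -> R) : integ h -> P.-integrable C (EFin \o h) by exact: integrable_on.
have iK := integrable_cst_fun P K mC.
have -> : \int[P]_(w in C) (y w - K) = \int[P]_(w in C) (z w - K).
  by rewrite !RintegralB//; try exact: iC; rewrite yz.
have iz' := integrable_pospart K0 iz.
apply: (@le_trans _ _ (\int[P]_(w in C) Num.max (z w - K) 0)).
  apply: le_Rintegral => //.
  - rewrite (_ : _ \o _ = (fun w => ((z w)%:E - K%:E)%E))//.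
    by apply: integrableB => //; exact: iC.
  - exact: iC.
  - by move=> w _; rewrite le_max lexx.
by apply: le_Rintegral_subset => // w; rewrite ?le_max ?lexx ?orbT//; case.
Qed.

Variable Y : R -> T -> R.
Hypothesis mY : martingale P F Y.

Lemma martingale_integrable t : 0 <= t -> integ (Y t).
Proof. by case: mY => _ + _; apply. Qed.

Lemma martingale_Rintegral s t B : 0 <= s -> s <= t -> F s B ->
  \int[P]_(w in B) Y s w = \int[P]_(w in B) Y t w.
Proof.
by move=> s0 st FB; have [_ _ /(_ s t s0 st)[_ _ /(_ B FB)]] := mY; rewrite /Rintegral => ->.
Qed.

(** The excess is the sum of the positive parts of Y - K and of - Y - K, and
    each is a submartingale. *)
Lemma martingale_excess K t u G : 0 <= K -> 0 <= t -> t <= u -> F t G ->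
  \int[P]_(w in G) excess K (Y t w) <= \int[P]_(w in G) excess K (Y u w).
Proof.
move=> K0 t0 tu FG; have u0 := le_trans t0 tu.
have it := martingale_integrable t0; have iu := martingale_integrable u0.
have iN (h : T -> R) : integ h -> integ (fun w => - h w).
  by move=> ih; rewrite (_ : _ \o _ = (fun w => - (h w)%:E)%E)//; exact: integrableN.
have mG := filtration_measurable hF t0 FG.
have E s : 0 <= s -> \int[P]_(w in G) excess K (Y s w) =
   \int[P]_(w in G) Num.max (Y s w - K) 0 + \int[P]_(w in G) Num.max (- Y s w - K) 0.
  move=> s0; have iYs := martingale_integrable s0.
  rewrite -RintegralD//; [|apply: integrable_on => //; exact: integrable_pospart..|].
    by apply: eq_Rintegral => w _; exact: excess_split.
  by apply: integrable_on => //; apply: integrable_pospart => //; exact: iN.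
have aY := let: And3 aY _ _ := mY in aY.
rewrite !E//; apply: lerD.
  apply: (pospart_mono (H := F t)) => //; first by move=> ?; exact: filtration_measurable.
    by move=> C FtC; exact: martingale_Rintegral.
  apply: (filtration_setI hF) => //; have := aY t t0 `]K, +oo[%classic (measurable_itv _).
  by congr (F t); apply/seteqP; split=> w /=; rewrite in_itv/= andbT.
apply: (pospart_mono (H := F t)) => //; [exact: iN|exact: iN|by move=> ?; exact: filtration_measurable| |].
  move=> C FtC; have mC := filtration_measurable hF t0 FtC.
  have N (h : T -> R) : integ h -> \int[P]_(w in C) (- h w) = - \int[P]_(w in C) h w.
    move=> ih; under eq_Rintegral do rewrite -mulN1r.
    by rewrite RintegralZl ?mulN1r//; exact: integrable_on.
  by rewrite !N// (martingale_Rintegral t0 tu).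
apply: (filtration_setI hF) => //; have := aY t t0 `]-oo, (- K)[%classic (measurable_itv _).
by congr (F t); apply/seteqP; split=> w /=; rewrite in_itv/= ltrNr.
Qed.

Lemma Rintegral_partition (Z : T -> R) (B : set T) (G : nat -> set T) n :
  integ Z -> measurable B -> (forall j, measurable (G j)) -> trivIset setT G ->
  (forall w, exists2 j, (j < n)%N & G j w) ->
  \int[P]_(w in B) Z w = \sum_(0 <= j < n) \int[P]_(w in B `&` G j) Z w.
Proof.
move=> iZ mB mG tG cG; have mBG j : measurable (B `&` G j) by exact: measurableI.
have E : B = \big[setU/set0]_(0 <= j < n) (B `&` G j).
  rewrite big_mkord -(bigcup_mkord n (fun j => B `&` G j)); apply/seteqP; split=> [w Bw|w [j _ []//]].
  by have [j jn Gj] := cG w; exists j.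
rewrite {1}/Rintegral {1}E integral_bigsetU_EFin//.
- by rewrite -sum_fine// => j _; apply: integrable_fin_num => //; exact: integrable_on.
- exact: iota_uniq.
- by move: (@trivIset_setIl _ _ setT G (fun=> B) tG); exact: sub_trivIset.
- by rewrite -E; case/integrableP: (integrable_on mB iZ).
Qed.

(** Z is the martingale stopped at a time taking the finitely many values tj j,
    on the events G j; everything reduces to a sum over these values. *)
Lemma simple_stopping n (G : nat -> set T) (tj : nat -> R) u (Z : T -> R) :
  trivIset setT G -> (forall w, exists2 j, (j < n)%N & G j w) ->
  (forall j, 0 <= tj j) -> (forall j, tj j <= u) -> (forall j, F (tj j) (G j)) ->
  (forall j w, G j w -> Z w = Y (tj j) w) ->
  [/\ integ Z,
      forall K, 0 <= K -> \int[P]_w excess K (Z w) <= \int[P]_w excess K (Y u w) &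
      forall s B, 0 <= s -> (forall j, s <= tj j) -> F s B ->
        \int[P]_(w in B) Z w = \int[P]_(w in B) Y u w].
Proof.
move=> tG cG tj0 tju FG ZY.
have mG j : measurable (G j) := filtration_measurable hF (tj0 j) (FG j).
have u0 : 0 <= u := le_trans (tj0 0%N) (tju 0%N).
have iY j := martingale_integrable (tj0 j); have iYu := martingale_integrable u0.
have mZ : measurable_fun setT Z.
  move=> _ C mC; rewrite setTI.
  have -> : Z @^-1` C = \bigcup_j (G j `&` Y (tj j) @^-1` C).
    apply/seteqP; split=> [w ZC|w [j _ [Gj YC]]]; last by rewrite /= (ZY j w Gj).
    by have [j _ Gj] := cG w; exists j => //; split => //; rewrite /= -(ZY j w Gj).
  apply: bigcupT_measurable => j; apply: measurableI => //.
  by rewrite -[X in measurable X]setTI; exact: (integrable_measurable (iY j)).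
have iZ : integ Z.
  have iS : integ (fun w => \sum_(0 <= j < n) `|Y (tj j) w|).
    rewrite (_ : _ \o _ = (fun w => \sum_(0 <= j < n) (`|Y (tj j) w|)%:E)%E); last first.
      by apply/funext => w /=; rewrite sumEFin.
    by apply: integrable_sum => // j _; exact: integrable_norm.
  apply: le_integrable iS => //; first exact/measurable_EFinP.
  move=> w _ /=; rewrite lee_fin [leRHS]ger0_norm ?sumr_ge0//.
  have [j jn Gj] := cG w; rewrite (ZY j w Gj) (bigD1_seq j) ?mem_index_iota ?iota_uniq//=.
  by rewrite lerDl sumr_ge0.
split=> // [K K0|s B s0 stj FB].
  rewrite (Rintegral_partition (integrable_excess K0 iZ) measurableT mG tG cG).
  rewrite (Rintegral_partition (integrable_excess K0 iYu) measurableT mG tG cG).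
  apply: ler_sum => j _; rewrite setTI.
  rewrite (@eq_Rintegral _ _ _ _ (G j) (fun w => excess K (Y (tj j) w))) => [|w].
    exact: martingale_excess.
  by rewrite inE => Gj; rewrite (ZY j w Gj).
have mB := filtration_measurable hF s0 FB.
rewrite (Rintegral_partition iZ mB mG tG cG) (Rintegral_partition iYu mB mG tG cG).
apply: eq_bigr => j _.
rewrite (@eq_Rintegral _ _ _ _ (B `&` G j) (Y (tj j))) => [|w].
  apply: martingale_Rintegral => //; apply: (filtration_setI hF) => //.
  exact: (filtration_le hF s0 (stj j)).
by rewrite inE => -[_ Gj]; rewrite (ZY j w Gj).
Qed.

(** The time rho is approximated from above by the dyadic times min (u, grid_up
    k rho), for which the result is a finite sum; their tails are uniformly
    controlled by the terminal variable Y u, and right continuity of the paths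
    identifies the limit. *)
Lemma optional_stopping s u (rho : T -> R) B : 0 <= s ->
  (forall w, s <= rho w <= u) ->
  (forall a, s <= a -> F a [set w | rho w <= a]) ->
  (forall w t, 0 <= t -> Y x w @[x --> t^'+] --> Y t w) -> F s B ->
  integ (fun w => Y (rho w) w) /\
  \int[P]_(w in B) Y (rho w) w = \int[P]_(w in B) Y s w.
Proof.
move=> s0 rhoP Frho Yrc FB.
have su : s <= u by have /andP[] := rhoP point; exact: le_trans.
have u0 := le_trans s0 su.
have rho0 w : 0 <= rho w by have /andP[+ _] := rhoP w; exact: le_trans.
(* Outside [s, u] the event is trivial, so it is already known at the nearest
   time of [s, u]. *)
have Fcut a : F (Num.max s (Num.min u a)) [set w | rho w <= a].
  have [ua|au] := leP u a.
    rewrite (_ : [set _ | _] = setT); first by apply: filtration_setT => //; rewrite le_max s0.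
    by apply/seteqP; split=> // w _ /=; have /andP[_ /le_trans] := rhoP w; apply.
  have [sa|as'] := leP s a; first exact: Frho.
  rewrite (_ : [set _ | _] = ~` setT); first by apply: filtration_setC => //; exact: filtration_setT.
  apply/seteqP; split=> // w /=; last by [].
  by have /andP[+ _] := rhoP w => sr /(le_trans sr); rewrite leNgt as'.
pose tj k j := Num.max s (Num.min u (grid k j)).
have tjm k i j : (i <= j)%N -> tj k i <= tj k j.
  move=> ij; have g := @le_grid R k i j ij.
  by rewrite /tj ge_max !le_max lexx /= le_min !ge_min lexx g !orbT.
pose G k j := [set w | grid_index k (rho w) = j].
pose Z k w := Y (Num.min u (grid_up k (rho w))) w.
have FG k j : F (tj k j) (G k j).
  have E i : [set w | (grid_index k (rho w) <= i)%N] = [set w | rho w <= grid k i].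
    by apply/seteqP; split=> w /=; rewrite grid_indexP.
  case: j => [|j].
    rewrite (_ : G k 0%N = [set w | (grid_index k (rho w) <= 0)%N]); first by rewrite E; exact: Fcut.
    by apply/seteqP; split=> w; rewrite /G/= leqn0 => /eqP.
  rewrite (_ : G k j.+1 = [set w | rho w <= grid k j.+1] `&` ~` [set w | rho w <= grid k j]).
    have tj0 i : 0 <= tj k i by rewrite le_max s0.
    apply: (filtration_setI hF) => //; first exact: Fcut.
    apply: (filtration_setC hF) => //.
    exact: (filtration_le hF (tj0 j) (tjm k _ _ (leqnSn j))) (Fcut _).
  rewrite -!E; apply/seteqP; split=> w /=; rewrite /G/=.
    by move=> ->; rewrite ltnn.
  by move=> [H /negP]; rewrite -ltnNge => H'; apply/eqP; rewrite eqn_leq H.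
have ZG k j w : G k j w -> Z k w = Y (tj k j) w.
  move=> Gj; rewrite /Z /tj /grid_up Gj; congr (Y _ w).
  rewrite max_r// le_min su /= -Gj (le_trans _ (le_grid_up _ _))//.
  by have /andP[] := rhoP w.
have tG k : trivIset setT (G k).
  apply/trivIsetP => i j _ _ ij; apply/seteqP; split=> // w [Gi Gj].
  by move: ij; rewrite -Gi -Gj eqxx.
have cG k w : exists2 j, (j < (grid_index k u).+1)%N & G k j w.
  exists (grid_index k (rho w)) => //; rewrite ltnS le_grid_index//.
  by have /andP[] := rhoP w.
have tj0 k j : 0 <= tj k j by rewrite le_max s0.
have tju k j : tj k j <= u by rewrite ge_max su ge_min lexx.
have S' k := simple_stopping (tG k) (cG k) (tj0 k) (tju k) (FG k) (ZG k).
have ZY w : Z k w @[k --> \oo] --> Y (rho w) w.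
  apply: (@cvg_at_right_seq _ (Y ^~ w) (rho w) (fun k => Num.min u (grid_up k (rho w)))).
  - by move=> k; rewrite le_min le_grid_up// andbT; have /andP[] := rhoP w.
  - apply: (@squeeze_cvgr _ _ _ _ (cst (rho w)) (fun k => grid_up k (rho w))).
    + apply: nearW => k; rewrite ge_min lexx orbT andbT le_min le_grid_up//= andbT.
      by have /andP[] := rhoP w.
    + exact: cvg_cst.
    + exact: cvg_grid_up.
  - exact: Yrc.
rewrite (martingale_Rintegral s0 su FB).
apply: (uniformly_integrable_limit (Z := Z) (y := Y u)) => //.
- exact: filtration_measurable FB.
- by move=> k; case: (S' k).
- exact: martingale_integrable.
- by move=> k K K0; case: (S' k) => _ + _; apply.
- by move=> k; have [_ _ H] := S' k; apply: (H s) => // j; rewrite /tj le_max lexx.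
Qed.

End optional_stopping.

(** * Total variation along the grid *)

Section dyadic_variation.
Context {R : realType}.
Implicit Types (f g h : R -> R) (F G H : cumulative R R) (K L : set (measurableTypeR R)).

Definition grid_variation k f t : R :=
  \sum_(0 <= i < grid_index k t) `|f (Num.min t (grid k i.+1)) - f (Num.min t (grid k i))|.

Lemma grid_variation_le k f t : finite_variation_path f -> 0 <= t ->
  grid_variation k f t <= fine (total_variation 0 t f).
Proof.
move=> fv t0; pose V s := fine (total_variation 0 s f).
pose a i := Num.min t (grid k i).
have -> : fine (total_variation 0 t f) =
   \sum_(0 <= i < grid_index k t) (V (a i.+1) - V (a i)).
  rewrite (telescope_sumr (fun i => V (a i)))// /a grid0.
  rewrite min_l; last exact: le_grid_up.
  by rewrite min_r// /V total_variationxx subr0.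
apply: ler_sum => i _; apply: total_variation_increment => //.
  by rewrite /a le_min t0 grid_ge0.
by rewrite /a le_min !ge_min lexx le_grid ?orbT.
Qed.

Lemma cvg_sum_nat n (u : nat -> nat -> R) (l : nat -> R) :
  (forall i, (i < n)%N -> u k i @[k --> \oo] --> l i) ->
  \sum_(0 <= i < n) u k i @[k --> \oo] --> \sum_(0 <= i < n) l i.
Proof.
elim: n => [|n IH] ul.
  by rewrite big_nil; under eq_fun do rewrite big_nil; exact: cvg_cst.
rewrite big_nat_recr//=; under eq_fun do rewrite big_nat_recr//=.
by apply: cvgD; [apply: IH => i /ltnW iN; exact: ul|exact: ul].
Qed.

(** By right continuity, the variation along any subdivision is the limit of the
    variations along its points rounded up to the grid, and the latter are part
    of the grid variation. The total variation is thus a countable supremum of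
    grid variations. *)
Lemma le_grid_variation f t c : cadlag_path f -> finite_variation_path f -> 0 <= t ->
  (forall k, grid_variation k f t <= c) -> fine (total_variation 0 t f) <= c.
Proof.
move=> cf fv t0 kc.
have tvf : total_variation 0 t f \is a fin_num by apply/bounded_variationP => //; exact: fv.
rewrite -lee_fin fineK//; apply: ge_ereal_sup => _ [_ [s st <-] <-]; rewrite lee_fin.
pose rho k x := Num.min t (grid_up k x).
have le_k k : variation 0 t (fun x => f (rho k x)) s <= c.
  apply: le_trans (kc k).
  pose g (x : R) : R := \sum_(0 <= i < grid_index k x) `|f (Num.min t (grid k i.+1)) - f (Num.min t (grid k i))|.
  have g0 : g 0 = 0.
    rewrite /g (_ : grid_index k 0 = 0)%N ?big_geq//.
    by apply/eqP; rewrite -leqn0 grid_indexP// grid0.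
  have -> : grid_variation k f t = g t - g 0 by rewrite g0 subr0.
  apply: variation_le_increment st _ => x y x0 xy yt.
  have ixy := le_grid_index k x0 xy.
  have -> : g y - g x =
     \sum_(grid_index k x <= i < grid_index k y) `|f (Num.min t (grid k i.+1)) - f (Num.min t (grid k i))|.
    by rewrite /g (@big_cat_nat _ _ _ (grid_index k x))//= addrAC subrr add0r.
  rewrite /rho /grid_up.
  rewrite -(telescope_sumr (fun i => f (Num.min t (grid k i))))//.
  exact: ler_norm_sum.
have cv : variation 0 t (fun x => f (rho k x)) s @[k --> \oo] --> variation 0 t f s.
  apply: (@cvg_sum_nat (size s)
    (fun k i => `|f (rho k (nth t (0 :: s) i.+1)) - f (rho k (nth t (0 :: s) i))|)) => n ns.
  have pt m : (m < (size s).+1)%N -> f (rho k (nth t (0 :: s) m)) @[k --> \oo] --> f (nth t (0 :: s) m).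
    move=> ms; have x0 := itv_partition_nth_ge ms st; have xt := itv_partition_nth_le ms st.
    set x := nth _ _ _ in x0 xt *.
    apply: (@cvg_at_right_seq _ f x (fun k => rho k x)).
    - by move=> k; rewrite le_min xt le_grid_up.
    - apply: (@squeeze_cvgr _ _ _ _ (cst x) (fun k => grid_up k x)).
      + by apply: nearW => k; rewrite /rho ge_min lexx orbT andbT le_min xt le_grid_up.
      + exact: cvg_cst.
      + exact: cvg_grid_up.
    - by case: cf => + _; apply.
  by apply: cvg_norm; apply: cvgB; apply: pt => //; exact: ltnW.
rewrite -(cvg_lim _ cv)//; apply: limr_le; first by apply/cvg_ex; eexists; exact: cv.
exact: nearW.
Qed.

Lemma total_variation_leP f t c : cadlag_path f -> finite_variation_path f -> 0 <= t ->
  fine (total_variation 0 t f) <= c <-> forall k, grid_variation k f t <= c.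
Proof.
move=> cf fv t0; split=> [Vc k|]; last exact: le_grid_variation.
exact: le_trans (grid_variation_le k fv t0) Vc.
Qed.

Definition debut F (c : R) : \bar R :=
  ereal_inf [set t%:E | t in [set t | 0 <= t /\ c <= F t]].

Lemma debut_ge0 F c : (0 <= debut F c)%E.
Proof. by apply: le_ereal_inf_tmp => _ [t [t0 _] <-]; rewrite lee_fin. Qed.

(** Right continuity makes the infimum attained, so that the debut of an adapted
    increasing process is a stopping time. *)
Lemma debut_leP F c t : 0 <= t -> (debut F c <= t%:E)%E <-> c <= F t.
Proof.
move=> t0; split=> [|cF]; last by apply: ereal_inf_lbound; exists t.
apply: contraPP => /negP; rewrite -ltNge => Ftc; apply/negP; rewrite -ltNge.
have /cvgr_lt/(_ c Ftc) [e /= e0 He] := cumulative_is_right_continuous F t.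
apply: (@lt_le_trans _ _ (t + e / 2)%:E).
  by rewrite lte_fin ltrDl divr_gt0.
apply: le_ereal_inf_tmp => _ [s [s0 cs] <-]; rewrite lee_fin leNgt; apply/negP => sE.
have : F (t + e / 2) < c.
  apply: He; last by rewrite ltrDl divr_gt0.
  by rewrite /= opprD addNKr normrN gtr0_norm ?divr_gt0// ltr_pdivrMr// ltr_pMr// ltr1n.
apply/negP; rewrite -leNgt (le_trans cs)//.
by apply: cumulative_is_nondecreasing; exact: ltW.
Qed.

End dyadic_variation.

(** * Integrals with the last jump isolated *)

Section charge_bound.
Context {R : realType}.
Implicit Types (f g h : R -> R) (F G H : cumulative R R) (K L : set (measurableTypeR R)).

Lemma LS_itvoo_le H t c : 0 < t -> (forall s, 0 <= s -> s < t -> H s - H 0 <= c) ->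
  (LS H `]0%R, t[%classic <= c%:E)%E.
Proof.
move=> t0 Hc; rewrite itv_bnd_open_bigcup.
pose I (n : nat) : set (measurableTypeR R) := `]0, t - n.+1%:R^-1]%classic.
have mI n : measurable (I n) by exact: measurable_itv.
have nd : nondecreasing_seq I.
  move=> n m nm; apply/subsetPset => x; rewrite /I/= !in_itv/= => /andP[-> /le_trans ->]//.
  by rewrite lerD2l lerN2 lef_pV2 ?posrE// ler_nat.
have cv : (LS H \o I) n @[n --> \oo] --> LS H (\bigcup_n I n).
  by apply: nondecreasing_cvg_mu => //; exact: bigcupT_measurable.
rewrite -(cvg_lim _ cv)//; apply: lime_le; first by apply/cvg_ex; eexists; exact: cv.
apply: nearW => n /=; rewrite /I; have [tn|tn] := leP 0 (t - n.+1%:R^-1); last first.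
  rewrite set_itv_ge ?measure0 ?bnd_simp -?leNgt ?(ltW tn)//.
  by rewrite lee_fin; have := Hc 0 (lexx _) t0; rewrite subrr.
by rewrite LS_itv// lee_fin Hc// ltrBlDr ltrDl invr_gt0.
Qed.

Definition stieltjes F G h t : R :=
  \int[LS F]_(s in `]0, t]) h s - \int[LS G]_(s in `]0, t]) h s.

Lemma LS_integrable F h c t : measurable_fun (`]0, t]%classic : set (measurableTypeR R)) h ->
  (forall s, s \in `]0, t] -> `|h s| <= c) ->
  (LS F).-integrable `]0, t] (EFin \o h).
Proof.
move=> mh hc; apply: measurable_bounded_integrable => //.
- by have := @LS_fin _ F t setT measurableT; rewrite setTI fin_numElt => /andP[].
- by apply: (bounded_on_le (c := c)) => s st; exact: hc.
Qed.

(** Before t the mass of dF is at most c1 and that of dG, with G = F - f, at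
    most 2 c1. The two atoms at t may be huge, but their difference is the jump
    of f, which is bounded by |f t - f 0| plus the masses accumulated before t.
    *)
Lemma stieltjes_bound f F G h t c c1 : 0 <= c -> 0 <= c1 -> decomposes f F G -> finite_variation_path f ->
  (forall s, 0 <= s -> F s = fine (total_variation 0 s f)) -> 0 <= t ->
  (forall s, 0 <= s -> s < t -> F s <= c1) -> 
  measurable_fun (`]0, t]%classic : set (measurableTypeR R)) h ->
  (forall s, s \in `]0, t] -> `|h s| <= c) ->
  `|stieltjes F G h t| <= c * (6 * c1 + `|f t - f 0|).
Proof.
move=> c0 c10 fFG fv FV; rewrite le_eqVlt => /predU1P[<- _ _ _|t0 Fc mh hc].
  rewrite /stieltjes set_itv_ge ?bnd_simp ?ltxx// !Rintegral_set0 !subrr !normr0.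
  by rewrite addr0 !mulr_ge0.
have F0 : F 0 = 0 by rewrite FV// total_variationxx.
pose oo : set (measurableTypeR R) := `]0, t[%classic.
have moo : measurable oo by exact: measurable_itv.
have mt : measurable ([set t] : set (measurableTypeR R)) by exact: measurable_set1.
have Eoc : `]0, t]%classic = oo `|` [set t].
  apply/seteqP; split=> x; rewrite /oo/= !in_itv/=.
    by move=> /andP[x0]; rewrite le_eqVlt => /predU1P[->|xt]; [right|left; rewrite x0].
  by move=> [/andP[-> /ltW]//|->]; rewrite t0 lexx.
have Fo : (LS F oo <= c1%:E)%E.
  by apply: LS_itvoo_le => // s s0 st; rewrite F0 subr0; exact: Fc.
have Go : (LS G oo <= (2 * c1)%:E)%E.
  apply: LS_itvoo_le => // s s0 st.
  have := total_variation_increment fv (lexx 0) s0; rewrite -!FV// F0.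
  have := ler_norm (f 0 - f s); rewrite distrC.
  move: (fFG s s0) (fFG 0 (lexx 0)) (Fc s s0 st); rewrite F0; lra.
(* The open interval, of mass o, is separated from the atom at t, of mass a. *)
have pieces H (c2 : R) : (LS H oo <= c2%:E)%E ->
   exists o a : R, [/\ LS H oo = o%:E, LS H [set t] = a%:E, 0 <= o <= c2, o + a = H t - H 0 &
     exists2 I, `|I| <= c * o & \int[LS H]_(s in `]0, t]) h s = I + h t * a].
  move=> Hc; have Hoo : LS H oo \is a fin_num.
    by rewrite ge0_fin_numE// (le_lt_trans Hc)// ltry.
  have LSE : (LS H `]0%R, t]%classic = LS H oo + LS H [set t])%E.
    rewrite Eoc measureU// /oo; apply/seteqP; split=> // x [+ /= xt].
    by rewrite xt /= in_itv/= ltxx andbF.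
  have Ht : LS H [set t] \is a fin_num.
    have : LS H `]0%R, t]%classic \is a fin_num by rewrite LS_itv// ltW.
    by rewrite LSE fin_numD => /andP[].
  exists (fine (LS H oo)), (fine (LS H [set t])); rewrite !fineK//; split => //.
  - by rewrite fine_ge0//= -lee_fin fineK.
  - by rewrite -fineD// -LSE LS_itv// ltW.
  have ih := LS_integrable H mh hc.
  have ioo : (LS H).-integrable oo (EFin \o h).
    apply: integrableS ih => //.
    by rewrite Eoc; exact: subsetUl.
  exists (\int[LS H]_(s in oo) h s).
    apply: le_trans (le_normr_Rintegral moo ioo) _.
    apply: (@le_trans _ _ (\int[LS H]_(s in oo) c)); last by rewrite Rintegral_cst.
    apply: le_Rintegral => //.
    + exact: integrable_norm.
    + apply: measurable_bounded_integrable => //.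
        by rewrite -ge0_fin_numE.
      by apply: (bounded_on_le (c := `|c|)).
    + move=> s; rewrite /oo/= in_itv/= => /andP[s0 st]; apply: hc.
      by rewrite in_itv/= s0 ltW.
  rewrite Eoc Rintegral_setU//; last 2 first.
  - by rewrite -Eoc.
  - by apply/disj_setPS => x [+ /= xt]; rewrite xt /oo/= in_itv/= ltxx andbF.
  congr (_ + _).
  transitivity (\int[LS H]_(s in ([set t] : set (measurableTypeR R))) h t).
    by apply: eq_Rintegral => s; rewrite inE/= => ->.
  by rewrite Rintegral_cst.
have [oF [aF [_ _ /andP[oF0 oF1] sF [IF IFb EF]]]] := pieces F _ Fo.
have [oG [aG [_ _ /andP[oG0 oG1] sG [IG IGb EG]]]] := pieces G _ Go.
have ht : `|h t| <= c by apply: hc; rewrite in_itv/= t0 lexx.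
rewrite /stieltjes EF EG.
have -> : IF + h t * aF - (IG + h t * aG) = IF - IG + h t * (aF - aG) by ring.
(* The atoms are eliminated through the total increments of F and G. *)
have aE : aF - aG = (f t - f 0) - oF + oG.
  by rewrite (fFG t (ltW t0)) (fFG 0 (lexx 0)); move: sF sG; clear; lra.
(* Here 3 = 1 + 2 from the masses of F and G before t; the integrals over the
   open interval contribute the same 3, whence the 6. *)
have ab : `|aF - aG| <= `|f t - f 0| + 3 * c1.
  rewrite aE; apply: le_trans (ler_normD _ _) _; rewrite (ger0_norm oG0).
  apply: le_trans (lerD (ler_normB _ _) (lexx _)) _; rewrite (ger0_norm oF0).
  by move: oF1 oG1; clear; lra.
apply: le_trans (ler_normD _ _) _; rewrite normrM.
have h1 : `|h t| * `|aF - aG| <= c * (`|f t - f 0| + 3 * c1) by exact: ler_pM.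
have h2 : `|IF - IG| <= c * (3 * c1).
  apply: le_trans (ler_normB _ _) _.
  apply: le_trans (lerD IFb IGb) _; rewrite -mulrDr ler_wpM2l//.
  by move: oF1 oG1; clear; lra.
apply: le_trans (lerD h2 h1) _; rewrite -mulrDr ler_wpM2l//.
by clear; lra.
Qed.

End charge_bound.

(** * Change of variable *)

Section chain_rule.
Context {R : realType}.
Implicit Types (f g h : R -> R) (F G H : cumulative R R) (K L : set (measurableTypeR R)).

(** A bounded substitute for the square: nonnegative, zero only at 0, with
    difference quotient bounded by 1. *)
Definition phi (x : R) : R := x ^+ 2 / (1 + x ^+ 2).
(** The difference quotient of phi, in a form that makes sense on the diagonal
    as well, so that jumps and continuous variation are treated alike. *)
Definition phi_slope (a b : R) : R := (a + b) / ((1 + a ^+ 2) * (1 + b ^+ 2)).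

Let sq1_gt0 (x : R) : 0 < 1 + x ^+ 2.
Proof. by rewrite ltr_wpDr ?sqr_ge0. Qed.

Lemma phi_slopeE a b : phi b - phi a = phi_slope a b * (b - a).
Proof.
rewrite /phi /phi_slope; field.
by rewrite !gt_eqF.
Qed.

Lemma phi_slope_le1 a b : `|phi_slope a b| <= 1.
Proof.
have p := mulr_gt0 (sq1_gt0 a) (sq1_gt0 b).
rewrite /phi_slope normrM normfV (gtr0_norm p) ler_pdivrMr// mul1r.
have := sqr_ge0 (a - 1); have := sqr_ge0 (b - 1); have := sqr_ge0 (a * b).
have := sqr_ge0 (a + 1); have := sqr_ge0 (b + 1).
have := sqr_ge0 a; have := sqr_ge0 b.
by rewrite ler_norml; clear; rewrite !expr2 => *; apply/andP; split; lra.
Qed.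

Lemma phi_ge0 x : 0 <= phi x.
Proof. by rewrite /phi divr_ge0 ?sqr_ge0// ltW. Qed.

Lemma phi_le1 x : phi x <= 1.
Proof. by rewrite /phi ler_pdivrMr// mul1r lerDr. Qed.

Lemma phi_eq0 x : phi x = 0 -> x = 0.
Proof.
move=> /eqP; rewrite /phi mulf_eq0 invr_eq0 (gt_eqF (sq1_gt0 x)) orbF sqrf_eq0.
by move/eqP.
Qed.

Lemma cvg_phi_slope (u v : nat -> R) a b : (u k @[k --> \oo] --> a) -> (v k @[k --> \oo] --> b) ->
  phi_slope (u k) (v k) @[k --> \oo] --> phi_slope a b.
Proof.
move=> ua vb; have sq (w : nat -> R) (c : R) : (w k @[k --> \oo] --> c) -> 1 + w k ^+ 2 @[k --> \oo] --> 1 + c ^+ 2.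
  by move=> wc; apply: cvgD; [exact: cvg_cst|rewrite expr2; under eq_fun do rewrite expr2; exact: cvgM].
apply: cvgM; first exact: cvgD.
apply: cvgV; first by rewrite mulf_neq0 ?gt_eqF.
by apply: cvgM; exact: sq.
Qed.

Lemma measurable_phi d (T : measurableType d) (D : set T) (Z : T -> R) :
  measurable_fun D Z -> measurable_fun D (fun w => phi (Z w)).
Proof.
move=> mZ; have c : continuous phi.
  move=> x; apply: cvgM; first by exact: exprn_continuous.
  apply: cvgV; first by rewrite gt_eqF.
  by apply: cvgD; [exact: cvg_cst|exact: exprn_continuous].
by apply: (measurableT_comp (continuous_measurable_fun c)).
Qed.

Lemma measurable_phi_slope d (T : measurableType d) (D : set T) (Y Z : T -> R) :
  measurable_fun D Y -> measurable_fun D Z ->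
  measurable_fun D (fun w => phi_slope (Y w) (Z w)).
Proof.
move=> mY mZ; rewrite /phi_slope; apply: measurable_funM; first exact: measurable_funD.
pose q (x : R) : R := (1 + x ^+ 2)^-1.
have -> : (fun x => ((1 + Y x ^+ 2) * (1 + Z x ^+ 2))^-1) = (fun x => q (Y x) * q (Z x)).
  by apply/funext => x; rewrite invfM.
have c : continuous q.
  move=> x; apply: cvgV; first by rewrite gt_eqF.
  by apply: cvgD; [exact: cvg_cst|exact: exprn_continuous].
by apply: measurable_funM; apply: (measurableT_comp (continuous_measurable_fun c)).
Qed.

Definition grid_slope f t k s : R :=
  phi_slope (f (Num.min t (grid_down k s))) (f (Num.min t (grid_up k s))).

Lemma grid_slope_cvg f t s : cadlag_path f -> 0 < s -> s <= t ->
  grid_slope f t k s @[k --> \oo] --> phi_slope (left_limit f s) (f s).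
Proof.
move=> cf s0 st; apply: cvg_phi_slope.
  have := cadlag_grid_down cf (ltW s0).
  apply: cvg_trans; apply: near_eq_cvg; apply: nearW => k; congr f.
  by rewrite min_r// ltW// (lt_le_trans (grid_down_lt k s0)).
apply: (@cvg_at_right_seq _ f s (fun k => Num.min t (grid_up k s))).
- by move=> k; rewrite le_min st le_grid_up// ltW.
- apply: (@squeeze_cvgr _ _ _ _ (cst s) (fun k => grid_up k s)).
  + by apply: nearW => k; rewrite ge_min lexx orbT andbT le_min st le_grid_up// ltW.
  + exact: cvg_cst.
  + by apply: cvg_grid_up; exact: ltW.
- by case: cf => + _; apply; exact: ltW.
Qed.

(** On each cell the integrand is constant, so its integral is a finite sum of
    difference quotients times increments, which telescopes for F - G. *)
Lemma grid_slope_integral f t k n : 0 <= t ->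
  let a i := Num.min t (grid k i) in
  measurable_fun (`]0, (a n)]%classic : set (measurableTypeR R)) (grid_slope f t k) /\
  forall H, \int[LS H]_(s in `]0, (a n)]) grid_slope f t k s =
    \sum_(0 <= i < n) phi_slope (f (a i)) (f (a i.+1)) * (H (a i.+1) - H (a i)).
Proof.
move=> t0 a; have a0 i : 0 <= a i by rewrite le_min t0 grid_ge0.
elim: n => [|n [mh IH]].
  have -> : a 0%N = 0 by rewrite /a grid0 min_r.
  split=> [|H]; first by rewrite set_itv_ge ?bnd_simp ?ltxx//; exact: measurable_fun_set0.
  by rewrite set_itv_ge ?bnd_simp ?ltxx// Rintegral_set0 big_nil.
have aS : a n <= a n.+1 by rewrite /a le_min !ge_min lexx le_grid ?orbT.
have Eoc : `]0, (a n.+1)]%classic = `]0, (a n)]%classic `|` `](a n), (a n.+1)]%classic.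
  apply/seteqP; split=> x /=; rewrite !in_itv/=.
    move=> /andP[x0 xa]; have [xn|nx] := leP x (a n); [left|right] => //.
    by rewrite x0.
  by move=> [/andP[-> /le_trans ->]//|/andP[/(le_lt_trans (a0 n)) -> ->]].
have cell s : s \in `](a n), (a n.+1)] -> grid_slope f t k s = phi_slope (f (a n)) (f (a n.+1)).
  rewrite in_itv/= => /andP[ns sn].
  have nt : grid k n < t.
    rewrite ltNge; apply/negP => tn; move: (lt_le_trans ns sn).
    by rewrite /a !min_l ?ltxx// (le_trans tn)// le_grid.
  have ns' : grid k n < s by move: ns; rewrite /a min_r// ltW.
  have sn' : s <= grid k n.+1 by move: sn; rewrite /a le_min => /andP[].
  by rewrite /grid_slope /grid_up /grid_down (grid_index_cell ns' sn').
have mI1 : measurable (`]0, (a n)]%classic : set (measurableTypeR R)) by exact: measurable_itv.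
have mI2 : measurable (`](a n), (a n.+1)]%classic : set (measurableTypeR R)) by exact: measurable_itv.
have mU : measurable_fun (`]0, (a n.+1)]%classic : set (measurableTypeR R)) (grid_slope f t k).
  rewrite Eoc; apply/measurable_funU => //; split => //.
  apply: (eq_measurable_fun (fun=> phi_slope (f (a n)) (f (a n.+1)))) => //.
  by move=> s; rewrite inE => /cell ->.
split=> // H; rewrite big_nat_recr//= -IH Eoc Rintegral_setU//.
- congr (_ + _).
  transitivity (\int[LS H]_(s in (`](a n), (a n.+1)]%classic : set (measurableTypeR R))) phi_slope (f (a n)) (f (a n.+1))).
    by apply: eq_Rintegral => s; rewrite inE; exact: cell.
  by rewrite Rintegral_cst// [X in _ * fine X](LS_itv H aS).
- rewrite -Eoc; apply: (LS_integrable H (c := 1)) => // s _; exact: phi_slope_le1.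
- apply/disj_setPS => x [/=]; rewrite !in_itv/= => /andP[_ xn] /andP[].
  by rewrite ltNge xn.
Qed.

(** The identity is a telescoping sum for the slopes between consecutive grid
    points; these are bounded by 1 and converge to the slope between the left
    limit and the value. *)
Lemma chain_rule f F G t : cadlag_path f -> decomposes f F G -> 0 <= t ->
  measurable_fun (`]0, t]%classic : set (measurableTypeR R))
     (fun s => phi_slope (left_limit f s) (f s)) /\
  phi (f t) - phi (f 0) = stieltjes F G (fun s => phi_slope (left_limit f s) (f s)) t.
Proof.
move=> cf fFG t0; pose a k i := Num.min t (grid k i).
have at_ k : a k (grid_index k t) = t by rewrite /a min_l// le_grid_up.
have at0 k : a k 0%N = 0 by rewrite /a grid0 min_r.
have a0 k i : 0 <= a k i by rewrite le_min t0 grid_ge0.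
have mk k : measurable_fun (`]0, t]%classic : set (measurableTypeR R)) (grid_slope f t k).
  by have [+ _] := grid_slope_integral f k (grid_index k t) t0; rewrite -/(a k _) at_.
have Sk k : stieltjes F G (grid_slope f t k) t = phi (f t) - phi (f 0).
  have [_ E] := grid_slope_integral f k (grid_index k t) t0.
  move: (E F) (E G); rewrite -/(a k _) at_ /stieltjes => -> ->.
  have T := telescope_sumr (fun i => phi (f (a k i))) (leq0n (grid_index k t)).
  rewrite at_ at0 in T; rewrite -sumrB -T.
  apply: eq_bigr => i _; rewrite phi_slopeE -mulrBr; congr (_ * _).
  by rewrite !fFG//; lra.
have cv H : (LS H).-integrable `]0, t] (EFin \o (fun s => phi_slope (left_limit f s) (f s))) /\
   \int[LS H]_(s in `]0, t]) grid_slope f t k s @[k --> \oo] -->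
   \int[LS H]_(s in `]0, t]) phi_slope (left_limit f s) (f s).
  apply: (Rintegral_dominated_cvg (g := fun=> 1)) => //.
  - by move=> s /=; rewrite in_itv/= => /andP[s0 st]; exact: grid_slope_cvg.
  - apply: (LS_integrable H (c := 1)) => //.
    by move=> s _; rewrite normr1.
  - by move=> k s _; exact: phi_slope_le1.
split.
  by have [/integrableP[/measurable_EFinP]] := cv F.
have : stieltjes F G (grid_slope f t k) t @[k --> \oo] -->
   stieltjes F G (fun s => phi_slope (left_limit f s) (f s)) t.
  by apply: cvgB; [case: (cv F)|case: (cv G)].
under eq_fun do rewrite Sk.
by move=> /(cvg_unique (@Rhausdorff R) (cvg_cst _)).
Qed.

End chain_rule.

(** * Slicing a bounded integrand into level sets *)

Section quantization.
Context {R : realType}.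
Implicit Types (f g h : R -> R) (F G H : cumulative R R) (K L : set (measurableTypeR R)).

(** The values -1 + (j + 1) / N: with j < 2 N they cut [-1, 1] into steps of
    length 1 / N. *)
Definition level (N j : nat) : R := j.+1%:R / N%:R - 1.

Lemma sum_lt_nat (n p : nat) : (p <= n)%N -> (\sum_(0 <= j < n) (j < p : nat) = p)%N.
Proof.
move=> pn; rewrite (@big_cat_nat _ _ _ p)//=.
rewrite [X in (_ + X)%N]big_nat_cond [X in (_ + X)%N]big1 ?addn0; last first.
  by move=> j /andP[/andP[pj _] _]; rewrite ltnNge pj.
rewrite big_nat_cond (eq_bigr (fun=> 1%N)) => [|j /andP[/andP[_ ->]]//].
by rewrite -big_nat_cond sum_nat_const_nat muln1 subn0.
Qed.

(** The number of levels not exceeding x is the integer part of (x + 1) N. *)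
Lemma quantize (x : R) N : (0 < N)%N -> `|x| <= 1 ->
  `|x - (N%:R^-1 * \sum_(0 <= j < 2 * N) (level N j <= x)%R%:R - 1)| <= N%:R^-1.
Proof.
move=> N0; rewrite ler_norml => /andP[x1 x2].
have N0' : 0 < N%:R :> R by rewrite ltr0n.
(* With y, the condition on the level reads j + 1 <= y. *)
pose y := (x + 1) * N%:R.
have y0 : 0 <= y by rewrite mulr_ge0//; lra.
have y2 : y <= (2 * N)%:R by rewrite natrM ler_wpM2r//; lra.
have -> : \sum_(0 <= j < 2 * N) ((level N j <= x)%R%:R : R) = (Num.truncn y)%:R.
  under eq_bigr => j _.
    rewrite (_ : (level N j <= x)%R = (j < Num.truncn y)%N); first by over.
    by rewrite /level lerBlDr ler_pdivrMr// -/y truncn_ge_nat.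
  rewrite -natr_sum sum_lt_nat//.
  by rewrite -(ler_nat R) (le_trans _ y2)// truncn_le.
have -> : x - (N%:R^-1 * (Num.truncn y)%:R - 1) = N%:R^-1 * (y - (Num.truncn y)%:R).
  by rewrite mulrBr /y mulrCA mulVf ?gt_eqF//; ring.
have /andP[t1 t2] := truncn_itv y0.
rewrite normrM gtr0_norm ?invr_gt0// ler_piMr ?invr_ge0 ?ler0n//.
by rewrite ger0_norm ?subr_ge0// lerBlDl natr1 ltW.
Qed.

Lemma charge_setU F G t K L : measurable K -> measurable L -> K `&` L = set0 ->
  charge F G t (K `|` L) = charge F G t K + charge F G t L.
Proof.
move=> mK mL KL.
have E H : fine (LS H ((K `|` L) `&` `]0%R, t]%classic)) =
    fine (LS H (K `&` `]0%R, t]%classic)) + fine (LS H (L `&` `]0%R, t]%classic)).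
  rewrite -fineD ?LS_fin// setIUl measureU//; try by apply: measurableI => //; exact: measurable_itv.
  by rewrite setIACA KL set0I.
by rewrite /charge !E; lra.
Qed.

Lemma charge_bigsetU F G t (K : nat -> set (measurableTypeR R)) n :
  (forall i, measurable (K i)) -> trivIset setT K ->
  \sum_(0 <= i < n) charge F G t (K i) = charge F G t (\big[setU/set0]_(i < n) K i).
Proof.
move=> mK tK; elim: n => [|n IH].
  by rewrite big_geq// big_ord0 /charge set0I !measure0 subrr.
rewrite big_nat_recr//= IH big_ord_recr/= charge_setU//.
  by apply: bigsetU_measurable => i _.
apply: (@trivIset_bigsetUI _ xpredT K _ n n) => //.
by apply: sub_trivIset tK.
Qed.

Lemma stieltjes_indicator F G t (b : R -> bool) :
  measurable ([set s | b s] `&` `]0, t] : set (measurableTypeR R)) ->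
  stieltjes F G (fun s => (b s)%:R) t = charge F G t [set s | b s].
Proof.
move=> mb; rewrite /stieltjes; have [_ ->] := indicator_integral F mb.
by have [_ ->] := indicator_integral G mb.
Qed.

Lemma charge_bound f F G t c1 K : 0 <= c1 -> decomposes f F G -> finite_variation_path f ->
  (forall s, 0 <= s -> F s = fine (total_variation 0 s f)) -> 0 <= t ->
  (forall s, 0 <= s -> s < t -> F s <= c1) -> measurable K ->
  `|charge F G t K| <= 6 * c1 + `|f t - f 0|.
Proof.
move=> c10 fFG fv FV t0 Fc mK.
have KE : K = [set s | s \in K] by apply/seteqP; split=> s /=; rewrite inE.
have mKI : measurable ([set s | s \in K] `&` `]0, t] : set (measurableTypeR R)).
  by rewrite -KE; apply: measurableI => //; exact: measurable_itv.
rewrite {1}KE -stieltjes_indicator// -[leRHS]mul1r.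
apply: (stieltjes_bound ler01 c10 fFG fv FV t0 Fc).
  have [/integrableP[/measurable_EFinP]] := indicator_integral F mKI.
  by [].
by move=> s _; case: (_ \in _); rewrite ?normr1 ?normr0.
Qed.

(** The integral of the quantized function is a combination of the charges of
    level sets. The last term is the integral of the constant -1 with which the
    levels start. *)
Lemma stieltjes_quantized f F G h t N : decomposes f F G -> 0 <= t ->
  measurable_fun (`]0, t]%classic : set (measurableTypeR R)) h ->
  let q s := N%:R^-1 * \sum_(0 <= j < 2 * N) ((level N j <= h s)%R%:R : R) - 1 in
  (forall H, (LS H).-integrable `]0, t] (EFin \o q)) /\
  stieltjes F G q t =
    N%:R^-1 * \sum_(0 <= j < 2 * N) charge F G t [set s | level N j <= h s] - (f t - f 0).
Proof.
move=> fFG t0 mh q.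
have mI : measurable (`]0, t]%classic : set (measurableTypeR R)) by exact: measurable_itv.
have mb j : measurable ([set s | level N j <= h s] `&` `]0, t] : set (measurableTypeR R)).
  have := mh mI `[level N j, +oo[%classic (measurable_itv _).
  rewrite setIC; congr (measurable (_ `&` _)).
  by apply/seteqP; split=> s /=; rewrite in_itv/= andbT.
have ib H j := (indicator_integral H (mb j)).1.
have Eb H j := (indicator_integral H (mb j)).2.
have S H n : (LS H).-integrable `]0, t] (EFin \o (fun s => \sum_(0 <= j < n) ((level N j <= h s)%R%:R : R))) /\
   \int[LS H]_(s in `]0, t]) (\sum_(0 <= j < n) ((level N j <= h s)%R%:R : R)) =
   \sum_(0 <= j < n) fine (LS H ([set s | level N j <= h s] `&` `]0%R, t]%classic)).
  elim: n => [|n [i1 i2]].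
    split.
      rewrite (_ : _ \o _ = (fun=> 0%E)); first exact: integrable0.
      by apply/funext => s /=; rewrite big_geq.
    rewrite big_geq//; under eq_Rintegral do rewrite big_geq//.
    by rewrite Rintegral_cst// mul0r.
  have EE : (fun s => \sum_(0 <= j < n.+1) ((level N j <= h s)%R%:R : R)) =
    (fun s => \sum_(0 <= j < n) ((level N j <= h s)%R%:R : R) + (level N n <= h s)%R%:R).
    by apply/funext => s; rewrite big_nat_recr.
  rewrite EE; split.
    rewrite (_ : _ \o _ = (fun s => (\sum_(0 <= j < n) ((level N j <= h s)%R%:R : R))%:E + ((level N n <= h s)%R%:R)%:E)%E)//.
    apply: integrableD => //. exact: ib.
  rewrite RintegralD//; last exact: ib.
  by rewrite [X in X + _]i2 big_nat_recr//= [X in _ + X = _]Eb.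
have i1 H : (LS H).-integrable `]0, t] (EFin \o (fun=> 1 : R)).
  by apply: (LS_integrable H (c := 1)) => // s _; rewrite normr1.
pose Sm (s : measurableTypeR R) : R := \sum_(0 <= j < 2 * N) ((level N j <= h s)%R%:R : R).
have iS H : (LS H).-integrable `]0, t] (EFin \o Sm) := (S H (2 * N)%N).1.
have ES H := (S H (2 * N)%N).2.
have iZ H : (LS H).-integrable `]0, t] (EFin \o (fun s => N%:R^-1 * Sm s)).
  rewrite (_ : _ \o _ = (fun s => (N%:R^-1)%:E * (Sm s)%:E)%E)//.
  by apply: integrableZl => //; exact: iS.
split=> [H|].
  rewrite (_ : _ \o _ = (fun s => (N%:R^-1 * Sm s)%:E - 1%:E)%E)//.
  by apply: integrableB => //; [exact: iZ|exact: i1].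
have Iq H : \int[LS H]_(s in `]0, t]) q s =
   N%:R^-1 * \sum_(0 <= j < 2 * N) fine (LS H ([set s | level N j <= h s] `&` `]0%R, t]%classic)) - (H t - H 0).
  rewrite -ES -[X in _ - X]mul1r.
  have -> : 1 * (H t - H 0) = \int[LS H]_(s in `]0, t]) (1 : R).
    by rewrite Rintegral_cst// [X in _ = _ * fine X](LS_itv H t0).
  rewrite -(RintegralZl N%:R^-1 mI (iS H)).
  exact: (RintegralB mI (iZ H) (i1 H)).
rewrite /stieltjes !Iq /charge sumrB mulrBr !fFG//.
by clear; ring.
Qed.

(** Replacing the integrand of the change of variable by a step function of
    error 1 / N leaves an error which is integrable once f is stopped, by the
    bound with the last jump isolated. *)
Lemma quantized_chain_rule f F G t c1 N : (0 < N)%N -> 0 <= c1 ->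
  cadlag_path f -> finite_variation_path f -> decomposes f F G ->
  (forall s, 0 <= s -> F s = fine (total_variation 0 s f)) -> 0 <= t ->
  (forall s, 0 <= s -> s < t -> F s <= c1) ->
  `|phi (f t) - phi (f 0) - (N%:R^-1 * \sum_(0 <= j < 2 * N)
      charge F G t [set s | level N j <= phi_slope (left_limit f s) (f s)] - (f t - f 0))|
  <= N%:R^-1 * (6 * c1 + `|f t - f 0|).
Proof.
move=> N0 c10 cf fv fFG FV t0 Fc.
have [mh ->] := chain_rule cf fFG t0.
pose h (s : R) : R := phi_slope (left_limit f s) (f s).
rewrite -/h in mh *.
have [iq <-] := stieltjes_quantized N fFG t0 mh.
pose q (s : R) : R := N%:R^-1 * \sum_(0 <= j < 2 * N) ((level N j <= h s)%R%:R : R) - 1.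
rewrite -/q in iq *.
have ih H : (LS H).-integrable `]0, t] (EFin \o h).
  by apply: (LS_integrable H (c := 1)) => // s _; exact: phi_slope_le1.
have mI : measurable (`]0, t]%classic : set (measurableTypeR R)) by exact: measurable_itv.
have -> : stieltjes F G h t - stieltjes F G q t = stieltjes F G (fun s => h s - q s) t.
  have E H : \int[LS H]_(s in `]0, t]) (h s - q s) =
    \int[LS H]_(s in `]0, t]) h s - \int[LS H]_(s in `]0, t]) q s.
    exact: (RintegralB mI (ih H) (iq H)).
  rewrite /stieltjes !E.
  move: (\int[_]_(_ in _) h _) (\int[_]_(_ in _) q _) (\int[_]_(_ in _) h _) (\int[_]_(_ in _) q _).
  by clear => *; ring.
apply: (stieltjes_bound _ c10 fFG fv FV t0 Fc).
- by rewrite invr_ge0.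
- by apply: measurable_funB => //; case/integrableP: (iq F) => /measurable_EFinP.
- by move=> s _; apply: quantize => //; exact: phi_slope_le1.
Qed.

End quantization.

(** * Expectations of integrals of predictable sets *)

Section expectation.
Context {d : measure_display} {T : measurableType d} {R : realType}.
Variables (P : probability T R) (F : R -> set (set T)).
Hypothesis hF : filtration F.
Local Notation integ Z := (P.-integrable setT (EFin \o Z)).
Local Notation PT := (predictableType F).

(** The time rho is one at which D may have a large jump, the variation being
    bounded by c strictly before it; the last hypothesis is the form in which
    the martingale property enters. *)
Variables (D : R -> T -> R) (Fw Gw : T -> cumulative R R).
Hypotheses (aD : adapted F D) (pD : predictable F D) (cD : cadlag D) (vD : finite_variation D).
Hypothesis DFG : forall w, decomposes (D ^~ w) (Fw w) (Gw w).
Hypothesis FwE : forall w s, 0 <= s -> Fw w s = fine (total_variation 0 s (D ^~ w)).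

Variables (rho : T -> R) (c : R).
Hypotheses (mrho : measurable_fun setT rho) (rho0 : forall w, 0 <= rho w) (c0 : 0 <= c).
Hypothesis Fc : forall w s, 0 <= s -> s < rho w -> Fw w s <= c.
Hypothesis iD : integ (fun w => D (rho w) w - D 0 w).
Hypothesis mart : forall s B, 0 <= s -> F s B ->
  \int[P]_(w in B) (D (rho w) w - D (Num.min s (rho w)) w) = 0.

Let Q_charge (Q : set (R * T)) (w : T) := charge_process Fw Gw Q (rho w) w.
(** An integrable bound, common to all predictable sets, for the integrals up to
    rho; it makes the limits in the Dynkin class argument possible. *)
Let bnd (w : T) := 6 * c + `|D (rho w) w - D 0 w|.

Let ibnd : integ bnd.
Proof.
rewrite (_ : _ \o _ = (fun w => (6 * c)%:E + (`|D (rho w) w - D 0 w|)%:E)%E)//.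
apply: integrableD => //; first exact: integrable_cst_fun.
exact: (integrable_norm (f := fun w => D (rho w) w - D 0 w)).
Qed.

Let Q_bound Q w : measurable (Q : set PT) -> `|Q_charge Q w| <= bnd w.
Proof.
move=> mQ; rewrite /Q_charge /charge_process /bnd.
apply: (charge_bound c0 (DFG w) (vD w) (FwE w) (rho0 w) (@Fc w)).
exact: (measurable_section hF).
Qed.

Let Q_integrable Q : measurable (Q : set PT) -> integ (Q_charge Q).
Proof.
move=> mQ; apply: le_integrable ibnd => //.
  apply/measurable_EFinP; apply: (measurable_at_random_time hF) => //.
  exact: (predictable_charge hF aD pD DFG).
move=> w _ /=; rewrite lee_fin; apply: le_trans (Q_bound w mQ) _.
exact: ler_norm.
Qed.

Let charge_cell s u B w : 0 <= s -> s <= u ->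
  Q_charge (`]s, u] `*` B) w =
  ((fun w => (D (rho w) w - D (Num.min s (rho w)) w)
     - (D (rho w) w - D (Num.min u (rho w)) w)) \_ B) w.
Proof.
move=> s0 su; rewrite /Q_charge /charge_process patchE.
have [Bw|Bw] := pselect (B w); last first.
  rewrite memNset// (_ : [set _ | _] = set0).
    by rewrite /charge !set0I !measure0 subrr.
  by apply/seteqP; split=> // x [].
rewrite mem_set// (_ : [set x | _] = `]s, u]%classic); last first.
  by apply/seteqP; split=> // x [].
by rewrite (charge_itv (DFG w))//; ring.
Qed.

Let charge_after s w : 0 <= s ->
  Q_charge (`]s, +oo[ `*` setT) w = D (rho w) w - D (Num.min s (rho w)) w.
Proof.
move=> s0; rewrite /Q_charge /charge_process -charge_itvI.
pose u := Num.max s (rho w).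
have -> : [set x | (`]s, +oo[ `*` [set: T]) (x, w)] `&` `]0, (rho w)] =
  `]s, u]%classic `&` `]0, (rho w)].
  apply/seteqP; split=> x.
    move=> [[/=]]; rewrite !in_itv/= andbT => sx _ /andP[x0 xr].
    by split; rewrite ?x0 ?xr// sx /u le_max xr orbT.
  move=> [/=]; rewrite !in_itv/= => /andP[sx _] /andP[x0 xr].
  by split; [split => //; rewrite sx|rewrite x0].
rewrite charge_itvI (charge_itv (DFG w))//; last by rewrite /u le_max lexx.
by rewrite min_r// /u le_max lexx orbT.
Qed.

Let incr_integrable s : 0 <= s -> integ (fun w => D (rho w) w - D (Num.min s (rho w)) w).
Proof.
move=> s0.
have mS : measurable (`]s, +oo[ `*` setT : set PT).
  by apply: measurable_after => //; exact: filtration_setT.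
have := Q_integrable mS; apply: eq_integrable => // w _.
by congr EFin; exact: charge_after.
Qed.

(** On the generators ]s, u] * B the integral is an increment of D on an event
    known at time s, of mean zero by hypothesis; complements and disjoint unions
    preserve the property. *)
Lemma expectation_charge Q : measurable (Q : set PT) -> \int[P]_w Q_charge Q w = 0.
Proof.
move=> mQ.
suff H : forall Q, <<s predictable_generators F >> Q -> \int[P]_w Q_charge Q w = 0 by exact: H mQ.
have ET w : Q_charge setT w = D (rho w) w - D 0 w.
  rewrite /Q_charge /charge_process [X in charge _ _ _ X](_ : _ = setT); last by apply/seteqP.
  by rewrite (charge_setT (DFG w)).
have HT : \int[P]_w Q_charge setT w = 0.
  rewrite -[RHS](mart (lexx 0) (filtration_setT hF (lexx 0))); apply: eq_Rintegral => w _.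
  by rewrite ET min_l.
apply: (@dynkin_induction _ PT (predictable_generators F)) => //.
- exact: predictable_generators_setI.
- move=> _ [[B FB <-]|[s [u [B [s0 su FB ->]]]]].
    rewrite (@eq_Rintegral _ _ _ _ setT (fun=> 0)); first by rewrite Rintegral_cst// mul0r.
    move=> w _; rewrite /Q_charge /charge_process -charge_itvI (_ : _ `&` _ = set0).
      by rewrite /charge !set0I !measure0 subrr.
    apply/seteqP; split=> // x [/= [-> _]]; rewrite in_itv/=.
    by rewrite ltxx.
  have su' := ltW su; have u0 := le_trans s0 su'; have mB := filtration_measurable hF s0 FB.
  under eq_Rintegral do rewrite charge_cell//.
  rewrite -Rintegral_mkcond RintegralB//; try by apply: integrable_on => //; exact: incr_integrable.
  by rewrite (mart s0 FB) (mart u0 (filtration_le hF s0 su' FB)) subrr.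
- move=> S mS S0.
  rewrite (@eq_Rintegral _ _ _ _ setT (fun w => Q_charge setT w - Q_charge S w)).
    by rewrite RintegralB ?HT ?S0 ?subrr//; exact: Q_integrable.
  move=> w _; rewrite /Q_charge /charge_process.
  by rewrite -charge_setC//; exact: (measurable_section hF).
- move=> S mS tS S0.
  have mSw w i : measurable ([set s | S i (s, w)] : set (measurableTypeR R)).
    exact: (measurable_section hF).
  have tSw w : trivIset setT (fun i => [set s | S i (s, w)] : set (measurableTypeR R)).
    apply/trivIsetP => i j _ _ ij; apply/seteqP; split=> // s [Si Sj].
    by move/trivIsetP : tS => /(_ i j I I ij) /seteqP[+ _] => /(_ (s, w) (conj Si Sj)).
  have Qsum n w : \sum_(0 <= i < n) Q_charge (S i) w = Q_charge (\big[setU/set0]_(i < n) S i) w.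
    rewrite /Q_charge /charge_process charge_bigsetU//; congr (charge _ _ _ _).
    by rewrite -(bigcup_mkord n S) -(bigcup_mkord n (fun i => [set s | S i (s, w)])).
  have mbig n : measurable (\big[setU/set0]_(i < n) S i : set PT) by exact: bigsetU_measurable.
  have Isum n : \int[P]_w \sum_(0 <= i < n) Q_charge (S i) w = 0.
    elim: n => [|n IH].
      by under eq_Rintegral do rewrite big_geq//; rewrite Rintegral_cst// mul0r.
    under eq_Rintegral do rewrite big_nat_recr//=.
    rewrite RintegralD//; last exact: Q_integrable.
      by rewrite IH S0 addr0.
    by under [X in EFin \o X]eq_fun do rewrite Qsum; exact: Q_integrable.
  have [_ cv] : integ (Q_charge (\bigcup_n S n)) /\
     \int[P]_w \sum_(0 <= i < n) Q_charge (S i) w @[n --> \oo] --> \int[P]_w Q_charge (\bigcup_n S n) w.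
    apply: (Rintegral_dominated_cvg (g := bnd)) => //.
    + by move=> n; apply: measurable_sum => i; apply: integrable_measurable; exact: Q_integrable.
    + move=> w _; exact: charge_bigcup (mSw w) (tSw w).
    + by move=> n w _; rewrite Qsum; exact: Q_bound.
  by move: cv; under eq_fun do rewrite Isum; move=> /(cvg_unique (@Rhausdorff R) (cvg_cst _)) <-.
Qed.

(** The integrand of the change of variable is predictable, so its level sets
    are, and their integrals have mean zero; the error of the slicing is at most
    a multiple of 1 / N. *)
Lemma expectation_phi : \int[P]_w (phi (D (rho w) w) - phi (D 0 w)) = 0.
Proof.
pose h (p : R * T) := phi_slope (left_limit (D ^~ p.2) p.1) (D p.1 p.2).
have mh : measurable_fun (timespace : set PT) h.
  apply: measurable_phi_slope; last exact: (predictableP hF _).1 pD.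
  exact: (predictableP hF _).1 (predictable_left_limit hF aD cD).
pose Q N j := timespace `&` [set p : R * T | level N j <= h p].
have mQ N j : measurable (Q N j : set PT).
  have := mh (measurable_timespace hF) `[level N j, +oo[%classic (measurable_itv _).
  by congr (measurable (_ `&` _)); apply/seteqP; split=> p /=; rewrite in_itv/= andbT.
pose I w := phi (D (rho w) w) - phi (D 0 w).
pose IN N w := N%:R^-1 * \sum_(0 <= j < 2 * N) Q_charge (Q N j) w - (D (rho w) w - D 0 w).
have bI N w : (0 < N)%N -> `|I w - IN N w| <= N%:R^-1 * bnd w.
  move=> N0; have := quantized_chain_rule N0 c0 (cD w) (vD w) (DFG w) (FwE w) (rho0 w) (@Fc w).
  rewrite /I /IN /bnd; set S1 := \sum_(0 <= j < 2 * N) _.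
  (* The predictable set is cut down to nonnegative times, which does not affect
     charges over ]0, rho]. *)
  suff -> : S1 = \sum_(0 <= j < 2 * N) Q_charge (Q N j) w by [].
  apply: eq_bigr => j _.
  rewrite /Q_charge /charge_process -charge_itvI -[RHS]charge_itvI; congr (charge _ _ _ _).
  apply/seteqP; split=> s [Hs st]; split => //; last by case: Hs.
  split => //; split => //; move: st; rewrite /= !in_itv/= andbT.
  by move=> /andP[/ltW].
have S N n : integ (fun w => \sum_(0 <= j < n) Q_charge (Q N j) w) /\
   \int[P]_w (\sum_(0 <= j < n) Q_charge (Q N j) w) = 0.
  elim: n => [|n [i1 i2]].
    split.
      rewrite (_ : _ \o _ = (fun=> 0%E)); first exact: integrable0.
      by apply/funext => w /=; rewrite big_geq.
    by under eq_Rintegral do rewrite big_geq//; rewrite Rintegral_cst// mul0r.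
  have iQ := Q_integrable (mQ N n).
  have EE : (fun w => \sum_(0 <= j < n.+1) Q_charge (Q N j) w) =
    (fun w => \sum_(0 <= j < n) Q_charge (Q N j) w + Q_charge (Q N n) w).
    by apply/funext => w; rewrite big_nat_recr.
  rewrite EE; split; last by rewrite RintegralD// i2 expectation_charge// addr0.
  rewrite (_ : _ \o _ = (fun w => (\sum_(0 <= j < n) Q_charge (Q N j) w)%:E + (Q_charge (Q N n) w)%:E)%E)//.
  by apply: integrableD.
have D0 : \int[P]_w (D (rho w) w - D 0 w) = 0.
  rewrite -[RHS](mart (lexx 0) (filtration_setT hF (lexx 0))); apply: eq_Rintegral => w _.
  by rewrite min_l.
have iZ N : integ (fun w => N%:R^-1 * \sum_(0 <= j < 2 * N) Q_charge (Q N j) w).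
  rewrite (_ : _ \o _ = (fun w => (N%:R^-1)%:E * (\sum_(0 <= j < 2 * N) Q_charge (Q N j) w)%:E)%E)//.
  by apply: integrableZl => //; case: (S N (2 * N)%N).
have iIN N : integ (IN N).
  rewrite (_ : _ \o _ = (fun w => (N%:R^-1 * \sum_(0 <= j < 2 * N) Q_charge (Q N j) w)%:E - (D (rho w) w - D 0 w)%:E)%E)//.
  by apply: integrableB => //; exact: (iZ N).
have EIN N : \int[P]_w IN N w = 0.
  have [i1 i2] := S N (2 * N)%N.
  by rewrite /IN RintegralB// D0 RintegralZl// i2 mulr0 subr0.
have mI : measurable_fun setT I.
  apply: measurable_funB; apply: measurable_phi.
    exact: (measurable_at_random_time hF pD mrho rho0).
  exact: (measurable_at_random_time hF pD (measurable_cst (0 : R)) (fun=> lexx 0)).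
have iI : integ I.
  apply: le_integrable (integrable_cst_fun P 1 measurableT) => //; first exact/measurable_EFinP.
  move=> w _ /=; rewrite lee_fin normr1 /I ler_norml.
  have := phi_ge0 (D (rho w) w); have := phi_le1 (D (rho w) w).
  have := phi_ge0 (D 0 w); have := phi_le1 (D 0 w); move: (phi _) (phi _) => x y.
  by move=> *; apply/andP; split; lra.
have bE N : (0 < N)%N -> `|\int[P]_w I w| <= N%:R^-1 * \int[P]_w bnd w.
  move=> N0; rewrite -[X in `|X|]subr0 -(EIN N) -RintegralB//.
  have iB : integ (fun w => I w - IN N w).
    rewrite (_ : _ \o _ = (fun w => (I w)%:E - (IN N w)%:E)%E)//.
    by apply: integrableB => //; exact: (iIN N).
  apply: le_trans (le_normr_Rintegral measurableT iB) _.
  rewrite -RintegralZl//; apply: le_Rintegral => //.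
  - exact: (integrable_norm (f := fun w => I w - IN N w)).
  - rewrite (_ : _ \o _ = (fun w => (N%:R^-1)%:E * (bnd w)%:E)%E)//.
    by apply: integrableZl => //; exact: ibnd.
  - by move=> w _; exact: bI.
have cv : (harmonic n : R) * \int[P]_w bnd w @[n --> \oo] --> (0 : R).
  by rewrite -[X in _ --> X](mul0r (\int[P]_w bnd w)); apply: cvgM; [exact: cvg_harmonic|exact: cvg_cst].
apply/eqP; rewrite -normr_le0 -[leRHS](cvg_lim _ cv)//; apply: limr_ge.
  by apply/cvg_ex; eexists; exact: cv.
by apply: nearW => n; exact: (bE n.+1 isT).
Qed.

End expectation.

(** * Stopping times and increments of local martingales *)

Section stopping.
Context {d : measure_display} {T : measurableType d} {R : realType}.
Variables (P : probability T R) (F : R -> set (set T)).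
Hypothesis hF : filtration F.
Local Notation integ Z := (P.-integrable setT (EFin \o Z)).

Lemma ae_integrable (f g : T -> R) : measurable_fun setT f -> integ g ->
  {ae P, forall w, f w = g w} -> integ f.
Proof.
move=> mf ig fg; have mg := integrable_measurable ig.
apply/integrableP; split; first exact/measurable_EFinP.
rewrite (ae_eq_integral (fun w => `|(g w)%:E|)%E)//.
- by case/integrableP: ig.
- by apply: measurableT_comp => //; exact/measurable_EFinP.
- by apply: measurableT_comp => //; exact/measurable_EFinP.
- by apply: filterS fg => w /= ->.
Qed.

Lemma ae_Rintegral (f g : T -> R) B : measurable B ->
  measurable_fun setT f -> measurable_fun setT g ->
  {ae P, forall w, f w = g w} -> \int[P]_(w in B) f w = \int[P]_(w in B) g w.
Proof.
move=> mB mf mg fg; rewrite /Rintegral (ae_eq_integral (fun w => (g w)%:E))//.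
- exact/measurable_EFinP/measurable_funTS.
- exact/measurable_EFinP/measurable_funTS.
- by apply: filterS fg => w /= ->.
Qed.

Lemma measurable_le_sets (rho : T -> R) :
  (forall a, measurable [set w | rho w <= a]) -> measurable_fun setT rho.
Proof.
move=> mr; apply: (measurability _ (RGenOInfty.measurableE R)).
move=> _ [_ [a ->] <-]; rewrite setTI.
rewrite (_ : _ @^-1` _ = ~` [set w | rho w <= a]); first exact: measurableC.
by apply/seteqP; split=> w /=; rewrite in_itv/= andbT ltNge => /negP.
Qed.

Lemma filtration_setU s A B : 0 <= s -> F s A -> F s B -> F s (A `|` B).
Proof.
move=> s0 FA FB; have -> : A `|` B = ~` (~` A `&` ~` B).
  by rewrite setCI !setCK.
by apply: (filtration_setC hF) => //; apply: (filtration_setI hF) => //; exact: (filtration_setC hF).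
Qed.

Lemma fine_minE (x : R) (tau : \bar R) : (0 <= tau)%E ->
  (fine (Order.min x%:E tau))%:E = Order.min x%:E tau.
Proof.
case: tau => [r|_|//] /=.
  by move=> _; rewrite -EFin_min.
by rewrite min_l// leey.
Qed.

Lemma stopped_right_continuous (g : R -> R) (tau : \bar R) t :
  (forall t, 0 <= t -> g x @[x --> t^'+] --> g t) -> (0 <= tau)%E -> 0 <= t ->
  g (fine (Order.min x%:E tau)) @[x --> t^'+] --> g (fine (Order.min t%:E tau)).
Proof.
move=> grc; case: tau => [r|_|//] t0 => [|]; last first.
  rewrite min_l ?leey//=; apply: cvg_trans (grc _ t0); apply: near_eq_cvg.
  by apply: nearW => x; rewrite min_l ?leey.
move=> t0'; have [tr|rt] := ltP t r.
  rewrite min_l ?lee_fin ?(ltW tr)//=; apply: cvg_trans (grc _ t0'); apply: near_eq_cvg.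
  near=> x; rewrite min_l// lee_fin; near: x; exact: nbhs_right_le.
apply: cvg_near_cst; near=> x; congr (g (fine _)).
rewrite !min_r ?lee_fin//; apply: le_trans rt _; near: x; exact: nbhs_right_ge.
Unshelve. all: by end_near. Qed.

(** Before tau the stopped martingale coincides with M, so optional stopping
    applies at rho; for an increment starting at s it is applied at max (s,
    rho), which is at least s. *)
Lemma stopped_increment (M : R -> T -> R) (tau : T -> \bar R) (rho : T -> R) u :
  martingale P F (stopped M tau) -> cadlag M -> (forall w, (0 <= tau w)%E) ->
  (forall w, 0 <= rho w <= u) -> (forall w, ((rho w)%:E <= tau w)%E) ->
  (forall a, 0 <= a -> F a [set w | rho w <= a]) ->
  [/\ integ (M 0), integ (fun w => M (rho w) w) &
    forall s B, 0 <= s -> F s B ->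
      integ (fun w => M (rho w) w - M (Num.min s (rho w)) w) /\
      \int[P]_(w in B) (M (rho w) w - M (Num.min s (rho w)) w) = 0].
Proof.
move=> mart cM tau0 rhoP rtau Frho.
have u0 : 0 <= u by have /andP[] := rhoP point; exact: le_trans.
have sE x w : 0 <= x -> (x%:E <= tau w)%E -> stopped M tau x w = M x w.
  by move=> x0 xt; rewrite /stopped min_l.
have src w t : 0 <= t -> stopped M tau x w @[x --> t^'+] --> stopped M tau t w.
  move=> t0; apply: (@stopped_right_continuous (M ^~ w) (tau w) t) => //.
  by case: (cM w).
have i0 : integ (M 0).
  have := martingale_integrable mart (lexx 0); apply: eq_integrable => // w _ /=.
  by rewrite sE.
have ir : integ (fun w => M (rho w) w).
  have [+ _] := optional_stopping hF mart (lexx 0) rhoP Frho src (filtration_setT hF (lexx 0)).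
  apply: eq_integrable => // w _ /=; rewrite sE//.
  by case/andP: (rhoP w).
split=> // s B s0 FB; have [su|us] := leP s u; last first.
  have E w : M (rho w) w - M (Num.min s (rho w)) w = 0.
    rewrite min_r ?subrr//; have /andP[_ ru] := rhoP w.
    exact: le_trans ru (ltW us).
  split.
    rewrite (_ : _ \o _ = (fun=> 0%E)); first exact: integrable0.
    by apply/funext => w /=; rewrite E.
  under eq_Rintegral do rewrite E.
  by rewrite Rintegral_cst ?mul0r//; exact: (filtration_measurable hF s0 FB).
pose rho' w := Num.max s (rho w).
have rho'P w : s <= rho' w <= u.
  by rewrite /rho' le_max lexx ge_max su; case/andP: (rhoP w).
have Frho' a : s <= a -> F a [set w | rho' w <= a].
  move=> sa; have a0 := le_trans s0 sa.
  have := Frho a a0; congr (F a); apply/seteqP; split=> w /=; rewrite /rho' ge_max sa//.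
have [i1 E1] := optional_stopping hF mart s0 rho'P Frho' src FB.
have is1 := martingale_integrable mart s0.
have E w : M (rho w) w - M (Num.min s (rho w)) w =
    stopped M tau (rho' w) w - stopped M tau s w.
  rewrite /rho'; have /andP[r0 _] := rhoP w; have [sr|rs] := leP s (rho w).
    by rewrite !sE// (le_trans _ (rtau w))// lee_fin.
  by rewrite !subrr.
have mB := filtration_measurable hF s0 FB; split.
  have : integ (fun w => stopped M tau (rho' w) w - stopped M tau s w).
    rewrite (_ : _ \o _ = (fun w => (stopped M tau (rho' w) w)%:E - (stopped M tau s w)%:E)%E)//.
    apply: integrableB => //.
  by apply: eq_integrable => // w _ /=; rewrite E.
under eq_Rintegral do rewrite E.
rewrite RintegralB//; [|exact: integrable_on..].
by rewrite E1 subrr.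
Qed.

(** The total variation on [0, t] is a countable supremum of grid variations,
    each a finite sum of values known at time t. *)
Lemma total_variation_adapted (D : R -> T -> R) (t c : R) : adapted F D -> cadlag D ->
  finite_variation D -> 0 <= t ->
  F t [set w | c <= fine (total_variation 0 t (D ^~ w))].
Proof.
move=> aD cD vD t0.
pose FTt := g_sigma_algebraType (F t).
have mF (A : set FTt) : measurable A -> F t A.
  by rewrite /measurable/= sigma_algebra_id//; case: hF => + _ _; apply.
have Fm' (A : set FTt) : F t A -> measurable A by exact: sub_sigma_algebra.
have mD s : 0 <= s -> s <= t -> measurable_fun setT (D s : FTt -> R).
  move=> s0 st _ B mB; rewrite setTI; apply: Fm'.
  exact: (filtration_le hF s0 st) (aD s s0 B mB).
have le_c b : measurable ([set w | fine (total_variation 0 t (D ^~ w)) <= b] : set FTt).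
  have -> : [set w | fine (total_variation 0 t (D ^~ w)) <= b] =
     \bigcap_k [set w | grid_variation k (D ^~ w) t <= b].
    apply/seteqP; split=> w /=.
      by move/(total_variation_leP _ (cD w) (vD w) t0) => H k _; exact: H.
    by move=> H; apply/(total_variation_leP _ (cD w) (vD w) t0) => k; exact: H.
  apply: bigcapT_measurable => k.
  have mv : measurable_fun setT (fun w : FTt => grid_variation k (D ^~ w) t).
    apply: measurable_sum => i; apply: measurableT_comp => //.
    by apply: measurable_funB; apply: mD; rewrite ?le_min ?t0 ?grid_ge0// ge_min lexx.
  have := mv measurableT `]-oo, b]%classic (measurable_itv _).
  by rewrite setTI; congr measurable; apply/seteqP; split=> w /=; rewrite in_itv.
apply: mF.
have -> : [set w | c <= fine (total_variation 0 t (D ^~ w))] =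
   ~` \bigcup_n [set w | fine (total_variation 0 t (D ^~ w)) <= c - n.+1%:R^-1].
  apply/seteqP; split=> w /=.
    move=> cv [n _] /= /(le_trans cv); rewrite lerBrDr gerDl leNgt invr_gt0.
    by rewrite ltr0n.
  move=> H; rewrite leNgt; apply/negP => vc; apply: H.
  have p : 0 < c - fine (total_variation 0 t (D ^~ w)) by rewrite subr_gt0.
  exists (Num.truncn (c - fine (total_variation 0 t (D ^~ w)))^-1) => //=.
  rewrite lerBrDr -lerBrDl; apply: ltW.
  by rewrite invf_plt ?posrE// truncnS_gt.
by apply: measurableC; apply: bigcupT_measurable.
Qed.

End stopping.

(** * Predictable local martingales of finite variation *)

Section uniqueness.
Context {d : measure_display} {T : measurableType d} {R : realType}.
Variables (P : probability T R) (F : R -> set (set T)).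
Hypothesis hF : filtration F.
Local Notation integ Z := (P.-integrable setT (EFin \o Z)).

(** The stopping time reduces both martingales, is bounded by u, and comes no
    later than the time when the variation of D reaches c. At that time phi of D
    has mean zero, and phi is nonnegative and vanishes only at 0. *)
Lemma stopped_zero (D M M' : R -> T -> R) (tau tau' : T -> \bar R)
    (Fw Gw : T -> cumulative R R) (u c : R) :
  adapted F D -> predictable F D -> cadlag D -> finite_variation D ->
  (forall w, decomposes (D ^~ w) (Fw w) (Gw w)) ->
  (forall w s, 0 <= s -> Fw w s = fine (total_variation 0 s (D ^~ w))) ->
  cadlag M -> cadlag M' ->
  {ae P, forall w, forall t, 0 <= t -> D t w = M t w - M' t w} ->
  {ae P, forall w, D 0 w = 0} ->
  stopping_time F tau -> stopping_time F tau' ->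
  martingale P F (stopped M tau) -> martingale P F (stopped M' tau') ->
  0 <= u -> 0 <= c ->
  {ae P, forall w, D (fine (Order.min u%:E
     (Order.min (Order.min (tau w) (tau' w)) (debut (Fw w) c)))) w = 0}.
Proof.
move=> aD pD cD vD DFG FwE cM cM' DM D0 [t0 st] [t0' st'] mM mM' u0 c0.
pose sigma w := Order.min (Order.min (tau w) (tau' w)) (debut (Fw w) c).
pose rho w := fine (Order.min u%:E (sigma w)).
have sigma0 w : (0 <= sigma w)%E by rewrite !le_min t0 t0' debut_ge0.
have rhoE w : (rho w)%:E = Order.min u%:E (sigma w) by exact: fine_minE.
have rhoP w : 0 <= rho w <= u.
  rewrite -!lee_fin rhoE le_min lee_fin u0 sigma0 /=.
  by rewrite ge_min lexx.
have rho0 w : 0 <= rho w by case/andP: (rhoP w).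
have rs w : ((rho w)%:E <= sigma w)%E by rewrite rhoE ge_min lexx orbT.
have rt w : ((rho w)%:E <= tau w)%E.
  by apply: le_trans (rs w) _; rewrite /sigma !ge_min lexx.
have rt' w : ((rho w)%:E <= tau' w)%E.
  by apply: le_trans (rs w) _; rewrite /sigma !ge_min lexx orbT.
have Frho a : 0 <= a -> F a [set w | rho w <= a].
  move=> a0; have [ua|au] := leP u a.
    rewrite (_ : [set _ | _] = setT); first exact: filtration_setT.
    by apply/seteqP; split=> // w _ /=; case/andP: (rhoP w) => _ /le_trans; apply.
  (* The debut lies below a exactly when the variation on [0, a] has reached c.
     *)
  rewrite (_ : [set _ | _] = ([set w | (tau w <= a%:E)%E] `|` [set w | (tau' w <= a%:E)%E])
     `|` [set w | c <= fine (total_variation 0 a (D ^~ w))]).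
    apply: (filtration_setU hF) => //; last exact: total_variation_adapted.
    by apply: (filtration_setU hF) => //; [exact: st|exact: st'].
  have E w : (rho w <= a) = [|| (tau w <= a%:E)%E, (tau' w <= a%:E)%E | (debut (Fw w) c <= a%:E)%E].
    have ua : (u%:E <= a%:E)%E = false by rewrite lee_fin leNgt au.
    by rewrite -lee_fin rhoE !ge_min ua /= orbA.
  apply/seteqP; split=> w /=; rewrite E.
    move=> /or3P[ta|ta|/(debut_leP _ _ a0)]; [by left; left|by left; right|right].
    by rewrite -FwE.
  move=> [[->//|->]|]; first by rewrite orbT.
  by rewrite -FwE// => /(debut_leP _ _ a0) ->; rewrite !orbT.
have mrho : measurable_fun setT rho.
  apply: measurable_le_sets => a; have [a0|a0] := leP 0 a.
    exact: (filtration_measurable hF a0) (Frho a a0).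
  rewrite (_ : [set _ | _] = set0); first exact: measurable0.
  by apply/seteqP; split=> // w /= ra; move: (le_lt_trans ra a0); rewrite ltNge rho0.
have Fc w s : 0 <= s -> s < rho w -> Fw w s <= c.
  move=> s0 sr; apply: ltW; rewrite ltNge; apply/negP => /(debut_leP _ _ s0).
  apply/negP; rewrite -ltNge; apply: (@lt_le_trans _ _ (rho w)%:E); first by rewrite lte_fin.
  by apply: le_trans (rs w) _; rewrite /sigma !ge_min lexx orbT.
have [i0 ir im] := stopped_increment hF mM cM t0 rhoP rt Frho.
have [i0' ir' im'] := stopped_increment hF mM' cM' t0' rhoP rt' Frho.
have mDt (r : T -> R) : measurable_fun setT r -> (forall w, 0 <= r w) ->
    measurable_fun setT (fun w => D (r w) w).
  by move=> mr r0; exact: (measurable_at_random_time hF pD mr r0).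
have mDr := mDt rho mrho rho0.
have mD0 : measurable_fun setT (D 0).
  exact: (mDt (fun=> 0) (measurable_cst _) (fun=> lexx 0)).
have isub (f g : T -> R) : integ f -> integ g -> integ (fun w => f w - g w).
  move=> jf jg; rewrite (_ : _ \o _ = (fun w => (f w)%:E - (g w)%:E)%E)//.
  by apply: integrableB.
have iD : integ (fun w => D (rho w) w - D 0 w).
  apply: (ae_integrable (g := fun w => (M (rho w) w - M' (rho w) w) - (M 0 w - M' 0 w))).
  - exact: measurable_funB.
  - by apply: (isub (fun w => M (rho w) w - M' (rho w) w) (fun w => M 0 w - M' 0 w)); exact: isub.
  - by apply: filterS DM => w H; rewrite !H.
(* D agrees with M - M' only almost surely, hence the detour through integrals
   of almost equal functions. *)
have mart s B : 0 <= s -> F s B ->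
    \int[P]_(w in B) (D (rho w) w - D (Num.min s (rho w)) w) = 0.
  move=> s0 FB; have [i1 E1] := im s B s0 FB; have [i2 E2] := im' s B s0 FB.
  have mB := filtration_measurable hF s0 FB.
  have i3 := isub _ _ i1 i2.
  rewrite (ae_Rintegral (g := fun w => (M (rho w) w - M (Num.min s (rho w)) w) -
     (M' (rho w) w - M' (Num.min s (rho w)) w)))//.
  - rewrite RintegralB//; [|exact: integrable_on..].
    by rewrite E1 E2 subrr.
  - apply: measurable_funB => //; apply: mDt.
      by apply: measurable_minr.
    by move=> w; rewrite le_min s0 rho0.
  - exact: (integrable_measurable i3).
  - apply: filterS DM => w H; rewrite !H ?le_min ?s0 ?rho0//.
    by ring.
have := expectation_phi hF aD pD cD vD DFG FwE mrho rho0 c0 Fc iD mart.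
have mphi := measurable_phi mDr.
have iphi : integ (fun w => phi (D (rho w) w)).
  apply: le_integrable (integrable_cst_fun P 1 measurableT) => //; first exact/measurable_EFinP.
  by move=> w _ /=; rewrite lee_fin normr1 ger0_norm ?phi_ge0// phi_le1.
rewrite (ae_Rintegral (g := fun w => phi (D (rho w) w))) => // [E| |]; last 2 first.
- by apply: measurable_funB => //; exact: measurable_phi.
- apply: filterS D0 => w ->.
  by rewrite [X in _ - X](_ : _ = 0) ?subr0// /phi expr0n mul0r.
have : ae_eq P setT (fun w => (phi (D (rho w) w))%:E) (cst 0%E).
  apply/ae_eq_integral_abs => //; first exact/measurable_EFinP.
  under eq_integral do rewrite gee0_abs ?lee_fin ?phi_ge0//.
  have fin := integrable_fin_num measurableT iphi.
  by rewrite -[LHS]fineK//; congr EFin.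
apply: filterS => w /= /(_ I) [] /phi_eq0.
by rewrite /rho /sigma.
Qed.

(** Both reducing sequences and the debuts of the levels n tend to infinity, so
    that D vanishes at each dyadic time outside a null set; there are countably
    many such times and paths are right-continuous. *)
Lemma predictable_local_martingale_zero (D M M' : R -> T -> R) :
  adapted F D -> predictable F D -> cadlag D -> finite_variation D ->
  local_martingale P F M -> local_martingale P F M' ->
  {ae P, forall w, forall t, 0 <= t -> D t w = M t w - M' t w} ->
  {ae P, forall w, D 0 w = 0} ->
  {ae P, forall w, forall t, 0 <= t -> D t w = 0}.
Proof.
move=> aD pD cD vD [_ cM [tau [st _ tauy mM]]] [_ cM' [tau' [st' _ tauy' mM']]] DM D0.
have /choice[FG FGP] : forall w, exists FG : cumulative R R * cumulative R R,
    decomposes (D ^~ w) FG.1 FG.2 /\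
    forall s, 0 <= s -> FG.1 s = fine (total_variation 0 s (D ^~ w)).
  move=> w; have [G1 [G2 [h1 h2]]] := jordan_decomposition (cD w) (vD w).
  by exists (G1, G2).
pose Fw w := (FG w).1; pose Gw w := (FG w).2.
have DFG w : decomposes (D ^~ w) (Fw w) (Gw w) by case: (FGP w).
have FwE w s : 0 <= s -> Fw w s = fine (total_variation 0 s (D ^~ w)).
  by case: (FGP w) => _; apply.
have H n k i := stopped_zero aD pD cD vD DFG FwE cM cM' DM D0 (st n) (st' n)
   (mM n) (mM' n) (grid_ge0 k i) (ler0n R n).
(* A single null set serves all levels and all dyadic times. *)
have {}H : {ae P, forall w, forall n k i, D (fine (Order.min (grid k i)%:E
     (Order.min (Order.min (tau n w) (tau' n w)) (debut (Fw w) n%:R)))) w = 0}.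
  by apply: ae_foralln => n; apply: ae_foralln => k; apply: ae_foralln => i; exact: H.
apply: filterS3 H tauy tauy' => w Hw ty ty' t t0.
have Dgrid k i : D (grid k i) w = 0.
  have : \forall n \near \oo, ((grid k i)%:E <= tau n w)%E /\
     ((grid k i)%:E <= tau' n w)%E /\ ((grid k i)%:E <= debut (Fw w) n%:R)%E.
    near=> n; split; [|split].
    - by near: n; move/cvgeyPge: ty; apply.
    - by near: n; move/cvgeyPge: ty'; apply.
    - apply: ltW; rewrite ltNge; apply/negP => /(debut_leP _ _ (grid_ge0 k i)).
      apply/negP; rewrite -ltNge; near: n; exact: nbhs_infty_gtr.
  case=> n _ /(_ n (leqnn n)) [h1 [h2 h3]].
  have := Hw n k i; rewrite min_l//.
  by rewrite !le_min h1 h2 h3.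
have := @cadlag_grid_up _ (D ^~ w) t (cD w) t0.
rewrite /grid_up; under eq_fun do rewrite Dgrid.
by move=> /(cvg_unique (@Rhausdorff R) (cvg_cst _)) <-.
Unshelve. all: by end_near. Qed.

End uniqueness.

(** * Measurability of cadlag paths *)

Section cadlag_measurable.
Context {R : realType}.
Implicit Types (f : R -> R).

Lemma measurable_grid_up f k t :
  measurable_fun (`]0, t]%classic : set (measurableTypeR R)) (fun s => f (grid_up k s)).
Proof.
move=> _ B mB.
rewrite [X in measurable X](_ : _ = \bigcup_(n in [set n | B (f (grid k n.+1))])
   (`]0, t]%classic `&` `](grid k n), (grid k n.+1)]%classic)).
  apply: bigcup_measurable => n _; apply: measurableI; exact: measurable_itv.
apply/seteqP; split=> [s [st Bs]|s [n Bn [st sn]]].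
  have s0 : 0 < s by move: st; rewrite /= in_itv/= => /andP[].
  have p := prednK (grid_index_gt0 k s0).
  exists (grid_index k s).-1; first by rewrite /= p.
  by split => //; rewrite /= in_itv/= p le_grid_up ?(ltW s0)// andbT grid_down_lt.
split => //; move: sn; rewrite /= in_itv/= => /andP[ns sn].
by rewrite /grid_up (grid_index_cell ns sn).
Qed.

Lemma cadlag_measurable f t : cadlag_path f ->
  measurable_fun (`]0, t]%classic : set (measurableTypeR R)) f.
Proof.
move=> cf; apply: (@measurable_fun_cvg _ (measurableTypeR R) R `]0, t]%classic
  (fun k s => f (grid_up k s))) => [k|s]; first exact: measurable_grid_up.
rewrite /= in_itv/= => /andP[s0 _]; exact: (cadlag_grid_up cf (ltW s0)).
Qed.

Lemma measurable_cadlag_neq0 f t : cadlag_path f ->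
  measurable ([set s | f s != 0] `&` `]0, t] : set (measurableTypeR R)).
Proof.
move=> cf; have mf := cadlag_measurable (t := t) cf.
have := mf (measurable_itv _) (~` [set 0]) (measurableC (measurable_set1 _)).
rewrite setIC; congr (measurable (_ `&` _)).
by apply/seteqP; split=> s /= => [/eqP|/eqP].
Qed.

End cadlag_measurable.

(** * Differences of processes *)

Section split.
Context {d : measure_display} {T : measurableType d} {R : realType}.
Variables (F : R -> set (set T)).
Hypothesis hF : filtration F.

Lemma cadlagB (A B : R -> T -> R) : cadlag A -> cadlag B -> cadlag (fun t w => A t w - B t w).
Proof.
move=> cA cB w; have [rA lA] := cA w; have [rB lB] := cB w; split=> t t0.
  by apply: cvgB; [exact: rA|exact: rB].
by apply: is_cvgB; [exact: lA|exact: lB].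
Qed.

Lemma finite_variationB (A B : R -> T -> R) : finite_variation A -> finite_variation B ->
  finite_variation (fun t w => A t w - B t w).
Proof.
move=> vA vB w t; rewrite le_eqVlt => /predU1P[<-|t0]; first exact: bounded_variationxx.
apply: bounded_variationD => //; first exact: (vA w t (ltW t0)).
exact: (bounded_variationN (vB w t (ltW t0))).
Qed.

Lemma adaptedB (A B : R -> T -> R) : adapted F A -> adapted F B ->
  adapted F (fun t w => A t w - B t w).
Proof.
move=> aA aB t t0 C mC; have sF : sigma_algebra setT (F t) by case: hF => + _ _; apply.
pose FTt := g_sigma_algebraType (F t).
have mF (X : R -> T -> R) : adapted F X -> measurable_fun setT (X t : FTt -> R).
  by move=> aX _ E mE; rewrite setTI; apply: sub_sigma_algebra; exact: aX.
have mAB : measurable_fun setT (fun w : FTt => A t w - B t w).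
  by apply: measurable_funB; [exact: mF aA|exact: mF aB].
have := mAB measurableT C mC.
by rewrite setTI /measurable/= sigma_algebra_id.
Qed.

Lemma predictableB (A B : R -> T -> R) : predictable F A -> predictable F B ->
  predictable F (fun t w => A t w - B t w).
Proof.
move=> pA pB; apply/(predictableP hF).
exact: measurable_funB ((predictableP hF _).1 pA) ((predictableP hF _).1 pB).
Qed.

End split.

(** * Splitting the finite variation part *)

Theorem theorem4 (d : measure_display) (T : measurableType d) (R : realType)
    (P : probability T R) (F : R -> set (set T)) (X M A : R -> T -> R)
    (hF : usual_conditions P F)
    (hX : semimartingale_decomposition P F X M A) :
  class_Sigma_g P F X <->
  exists C V : R -> T -> R,
    [/\ predictable F C, cadlag C & finite_variation C] /\
    [/\ predictable F V, cadlag V & finite_variation V] /\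
    {ae P, forall w, forall t, 0 <= t -> A t w = C t w + V t w} /\
    {ae P, forall w, forall t, 0 <= t ->
      LS_integral (C ^~ w) (fun s => (X s w != 0)%:R) t 0 /\
      LS_integral (V ^~ w)
        (fun s => (left_limit (X ^~ w) s != 0)%:R) t 0}.
Proof.
have [fF _ _] := hF.
have neq0E (x y : R) : (x * y != 0) = (x != 0) && (y != 0) by rewrite mulf_eq0 negb_or.
split; last first.
  move=> [C [V [_ [_ [ACV CV0]]]]]; exists M, A; split=> //.
  apply: filterS2 ACV CV0 => w ACV CV0 t t0.
  have -> : (fun s => (X s w * left_limit (X ^~ w) s != 0)%:R) =
      (fun s => ((X s w != 0) && (left_limit (X ^~ w) s != 0))%:R :> R).
    by apply/funext => s; rewrite neq0E.
  apply: (LS_integral_sum ACV) => // s s0; by case: (CV0 s s0).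
have [[aX cX XMA] [[lM M0] [aA pA cA vA A0]]] := hX.
move=> [M' [A' [[[_ _ XMA'] [[lM' M0'] [aA' pA' cA' vA' A0']]] I0]]].
(* The finite variation part A' given by the class is identified with A. *)
have D0 : {ae P, forall w, forall t, 0 <= t -> A' t w - A t w = 0}.
  apply: (predictable_local_martingale_zero fF (D := fun t w => A' t w - A t w)
    (adaptedB fF aA' aA) (predictableB fF pA' pA) (cadlagB cA' cA) (finite_variationB vA' vA) lM lM').
    apply: filterS2 XMA XMA' => w H H' t t0.
    by move: (H t t0) (H' t t0) => -> ; lra.
  by apply: filterS2 A0 A0' => w -> ->; rewrite subrr.
have /choice[FG FGP] : forall w, exists FG : cumulative R R * cumulative R R,
    decomposes (A ^~ w) FG.1 FG.2.
  move=> w; have [G1 [G2 [h1 _]]] := jordan_decomposition (cA w) (vA w).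
  by exists (G1, G2).
pose Fw w := (FG w).1; pose Gw w := (FG w).2.
(* The integral of 1_Q is the part C, that of its complement the part V. *)
pose Q : set (R * T) := timespace `&` [set p | left_limit (X ^~ p.2) p.1 != 0].
have mQ : measurable (Q : set (predictableType F)).
  have mL := (predictableP fF _).1 (predictable_left_limit fF aX cX).
  have := mL (measurable_timespace fF) (~` [set 0]) (measurableC (measurable_set1 _)).
  by congr (measurable (_ `&` _)); apply/seteqP; split=> s /= => [/eqP|/eqP].
have mQC : measurable (~` Q : set (predictableType F)) by exact: measurableC.
have mQw w : measurable ([set s | Q (s, w)] : set (measurableTypeR R)).
  exact: (measurable_section fF).
have mQCw w : measurable ([set s | (~` Q) (s, w)] : set (measurableTypeR R)).
  exact: (measurable_section fF).
pose C := charge_process Fw Gw Q; pose V := charge_process Fw Gw (~` Q).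
have path S : measurable (S : set (predictableType F)) ->
    [/\ predictable F (charge_process Fw Gw S), cadlag (charge_process Fw Gw S)
      & finite_variation (charge_process Fw Gw S)].
  move=> mS; split; first exact: (predictable_charge fF aA pA FGP).
    move=> w; have [F' [G' [h _]]] := charge_path_decomposition (Fw w) (Gw w) (measurable_section fF w mS).
    exact: decomposes_cadlag h.
  move=> w; have [F' [G' [h _]]] := charge_path_decomposition (Fw w) (Gw w) (measurable_section fF w mS).
  exact: decomposes_finite_variation h.
exists C, V; split; first exact: path; split; first exact: path; split.
  apply: filterS A0 => w A0w t t0.
  rewrite /C /V /charge_process.
  rewrite (_ : [set s | (~` Q) (s, w)] = ~` [set s | Q (s, w)])// charge_setC//.
  by rewrite (charge_setT (FGP w) t0) A0w; clear; ring.
have QE w t : [set s | Q (s, w)] `&` `]0, t] = [set s | left_limit (X ^~ w) s != 0] `&` `]0, t].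
  apply/seteqP; split=> s [H st]; split => //; first by case: H.
  by split => //; split => //; move: st; rewrite /= !in_itv/= andbT => /andP[/ltW].
apply: filterS2 D0 I0 => w D0w I0w t t0.
have A'FG : decomposes (A' ^~ w) (Fw w) (Gw w).
  move=> s s0; rewrite -(FGP w s s0); apply/eqP; rewrite -subr_eq0; apply/eqP; exact: D0w.
split.
- have [F' [G' [h Ch]]] := charge_path_decomposition (Fw w) (Gw w) (mQw w).
  have mX := measurable_cadlag_neq0 t (cX w).
  apply/(LS_integral_charge _ _ _ h); split=> //.
  have [_ E0] := (LS_integral_charge _ _ _ A'FG).1 (I0w t t0).
  rewrite -charge_itvI Ch// [LHS]E0 -[RHS]charge_itvI -[LHS]charge_itvI.
  congr (charge _ _ _ _); apply/seteqP; split=> s.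
    move=> [/=]; rewrite neq0E => /andP[Xs Ls] st; split=> //.
    have : ([set s | Q (s, w)] `&` `]0, t]) s by rewrite QE.
    by move=> [Qs _]; split.
  move=> [[[_ /= Ls] [Xs st]] _]; split => //=.
  by rewrite neq0E Xs.
- have [F' [G' [h Ch]]] := charge_path_decomposition (Fw w) (Gw w) (mQCw w).
  apply/(LS_integral_charge _ _ _ h).
  have mL : measurable ([set s | left_limit (X ^~ w) s != 0] `&` `]0, t] : set (measurableTypeR R)).
    by rewrite -QE; apply: measurableI => //; exact: measurable_itv.
  split=> //; rewrite -charge_itvI Ch// -QE setIA.
  rewrite (_ : _ `&` _ = set0) ?set0I /charge ?set0I ?measure0 ?subrr//.
  by apply/seteqP; split=> // s [[]].
Qed.
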